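(* Let $d,N$ be positive integers, let $p\in(1,\infty)$, and let $\mu_1,\dots,\mu_N\in\mathcal P_p^{\mathrm{ac}}(\mathbb R^d)$. Let $c:\mathbb R^{dN}\to\mathbb R$ be the infimal convolution cost $$c(x_1,\dots,x_N)=\inf_{z\in\mathbb R^d}\sum_{i=1}^N|x_i-z|^p .$$ Then $$C(\mu_1,\dots,\mu_N)=DC(\mu_1,\dots,\mu_N),$$ where $C$ is the multi-marginal optimal transport value with cost $c$ and $DC$ is the dynamical value, both defined in the context.
   Context: $|\cdot|$ is the Euclidean norm on $\mathbb R^d$. $\mathcal P(\mathbb R^n)$ is the set of Borel probability measures on $\mathbb R^n$; $\mathcal P_p(\mathbb R^d)=\{\mu\in\mathcal P(\mathbb R^d):\int_{\mathbb R^d}|x|^p\,\mathrm d\mu(x)<\infty\}$; $\mathcal P_p^{\mathrm{ac}}(\mathbb R^d)$ is the set of $\mu\in\mathcal P_p(\mathbb R^d)$ that are absolutely continuous with respect to Lebesgue measure $\mathcal L^d$. $\Pi(\mu_1,\dots,\mu_N)$ is the set of $\gamma\in\mathcal P(\mathbb R^{dN})$ whose marginals are $\mu_1,\dots,\mu_N$, where $\mathbb R^{dN}=(\mathbb R^d)^N$. Define $$C(\mu_1,\dots,\mu_N)=\inf_{\gamma\in\Pi(\mu_1,\dots,\mu_N)}\int_{\mathbb R^{dN}}c(x_1,\dots,x_N)\,\mathrm d\gamma(x_1,\dots,x_N).$$ Define $$DC(\mu_1,\dots,\mu_N)=\inf_{(\rho^i,v^i)_{i=1}^N}\int_0^1\sum_{i=1}^N\int_{\mathbb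 R^d}|v^i_t|^p\,\mathrm d\rho^i_t\,\mathrm dt,$$ where the infimum is over all families of (measurable in time) curves $\rho^i_t\in\mathcal P_p(\mathbb R^d)$ and (Borel, time-dependent) vector fields $v^i_t:\mathbb R^d\to\mathbb R^d$, $t\in[0,1]$, $i=1,\dots,N$, such that $\int_0^1\int_{\mathbb R^d}|v^i_t|\,\mathrm d\rho^i_t\,\mathrm dt<\infty$ for every $i$ and $$\partial_t\rho^i_t+\nabla\cdot(v^i_t\rho^i_t)=0,\qquad \rho^1_0=\dots=\rho^N_0,\qquad \rho^i_1=\mu_i\quad(i=1,\dots,N).$$ The common initial measure $\rho^1_0=\dots=\rho^N_0=:\nu\in\mathcal P_p(\mathbb R^d)$ is not prescribed. The continuity equations together with initial and terminal conditions are understood in the weak sense: for each $i$ and every $\varphi\in C_c^1([0,1]\times\mathbb R^d)$, $$\int_0^1\int_{\mathbb R^d}\big(\partial_t\varphi+\nabla_x\varphi\cdot v^i_t\big)\,\mathrm d\rho^i_t\,\mathrm dt=\int_{\mathbb R^d}\varphi(1,x)\,\mathrm d\mu_i(x)-\int_{\mathbb R^d}\varphi(0,x)\,\mathrm d\nu(x).$$ *)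

(* Defs.v *)
From HB Require Import structures.
From mathcomp Require Import all_boot all_order all_algebra.
From mathcomp Require Import all_classical all_reals all_analysis.
(* Not exported by [all_analysis]; gives [\bar R] its sigma-algebra. *)
From mathcomp Require Import measurable_realfun.

Set Implicit Arguments.
Unset Strict Implicit.
Unset Printing Implicit Defensive.
Import Order.TTheory GRing.Theory Num.Theory.
Import numFieldNormedType.Exports.
Local Open Scope classical_set_scope.
Local Open Scope ring_scope.

(* [R^d] is ['rV[R]_d] and [R^{dN} = (R^d)^N] is ['M[R]_(N, d)], the point
   [(x_1, ..., x_N)] being the matrix with rows [x_i].  The library gives
   matrices the product topology; its Borel sigma-algebra is installed here. *)
HB.instance Definition _ (R : realType) (m n : nat) :=
  Measurable.copy 'M[R]_(m, n)
    (g_sigma_algebraType (open : set (set 'M[R]_(m, n)))).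

Section euclidean.
Context {R : realType} {d : nat}.
Implicit Types (x y a b : 'rV[R]_d) (A : set 'rV[R]_d).

Definition dotp x y : R := \sum_(j < d) x ord0 j * y ord0 j.

(* The library norm [`|x|] on ['rV[R]_d] is the sup norm. *)
Definition enorm x : R := Num.sqrt (dotp x x).

Definition box a b : set 'rV[R]_d :=
  [set x | forall j, a ord0 j <= x ord0 j <= b ord0 j].

(* The Lebesgue (outer) measure on [R^d]; it is only used on Borel sets. *)
Definition lebesgue_rV A : \bar R :=
  ereal_inf [set (\sum_(0 <= k <oo)
                   (\prod_(j < d) ((ab k).2 ord0 j - (ab k).1 ord0 j))%:E)%E
            | ab in [set ab : nat -> 'rV[R]_d * 'rV[R]_d |
                     (forall k j, (ab k).1 ord0 j <= (ab k).2 ord0 j) /\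
                     A `<=` \bigcup_k box (ab k).1 (ab k).2]].

Definition Pp (p : R) : set (probability 'rV[R]_d R) :=
  [set mu | (\int[mu]_x (enorm x `^ p)%:E < +oo)%E].

Definition Pp_ac (p : R) : set (probability 'rV[R]_d R) :=
  [set mu | Pp p mu /\
            forall A, measurable A -> lebesgue_rV A = 0 -> mu A = 0].

(* [C_c^1([0,1] x R^d)], each element being represented by a C^1 extension to
   [R x R^d]; only its values for [t] in [[0, 1]] are used and the support
   condition only concerns those. *)
Definition Cc1 : set (R * 'rV[R]_d -> R) :=
  [set phi : R * 'rV[R]_d -> R |
    [/\ forall z, differentiable phi z,
        forall w, continuous (fun z => 'D_w phi z) &
        exists2 K : set 'rV[R]_d, compact K &
          forall (t : R) x, 0 <= t <= 1 -> ~ K x -> phi (t, x) = 0]].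

Definition dt (phi : R * 'rV[R]_d -> R) (z : R * 'rV[R]_d) : R :=
  'D_((1, 0) : R * 'rV[R]_d) phi z.

Definition gradx (phi : R * 'rV[R]_d -> R) (z : R * 'rV[R]_d) : 'rV[R]_d :=
  \row_j 'D_((0, delta_mx ord0 j) : R * 'rV[R]_d) phi z.

(* The weak form includes the initial condition [rho_0 = nu] and the terminal
   condition [rho_1 = mu]. *)
Definition weak_continuity_eq (rho : R -> probability 'rV[R]_d R)
    (v : R -> 'rV[R]_d -> 'rV[R]_d) (nu mu : probability 'rV[R]_d R) : Prop :=
  forall phi, Cc1 phi ->
    (\int[lebesgue_measure]_(t in `[0%R, 1%R])
       \int[rho t]_x (dt phi (t, x) + dotp (gradx phi (t, x)) (v t x))%:E =
     \int[mu]_x (phi (1%R, x))%:E - \int[nu]_x (phi (0%R, x))%:E)%E.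

Definition measurable_curve (p : R) (rho : R -> probability 'rV[R]_d R) : Prop :=
  (forall t : R, 0 <= t <= 1 -> Pp p (rho t)) /\
  (forall A, measurable A -> measurable_fun `[0 : R, 1] (fun t => rho t A)).

Definition borel_field (v : R -> 'rV[R]_d -> 'rV[R]_d) : Prop :=
  measurable_fun (`[0 : R, 1] `*` [set: 'rV[R]_d])
    (fun z : R * 'rV[R]_d => v z.1 z.2).

End euclidean.

Section transport.
Context {R : realType} {d N : nat}.
Implicit Types (mu : 'I_N -> probability 'rV[R]_d R)
  (rho : 'I_N -> R -> probability 'rV[R]_d R)
  (v : 'I_N -> R -> 'rV[R]_d -> 'rV[R]_d).

Definition couplings mu : set (probability 'M[R]_(N, d) R) :=
  [set gamma | forall i A, measurable A -> pushforward gamma (row i) A = mu i A].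

Definition mmot_value (c : 'M[R]_(N, d) -> R) mu : \bar R :=
  ereal_inf [set (\int[gamma]_x (c x)%:E)%E | gamma in couplings mu].

Definition infconv_cost (p : R) (x : 'M[R]_(N, d)) : R :=
  inf [set \sum_(i < N) enorm (row i x - z) `^ p | z in [set: 'rV[R]_d]].

Definition admissible (p : R) mu
    : set (('I_N -> R -> probability 'rV[R]_d R) *
           ('I_N -> R -> 'rV[R]_d -> 'rV[R]_d)) :=
  [set rv |
    (forall i, [/\ measurable_curve p (rv.1 i), borel_field (rv.2 i) &
       (\int[lebesgue_measure]_(t in `[0%R, 1%R])
          \int[rv.1 i t]_x (enorm (rv.2 i t x))%:E < +oo)%E]) /\
    (exists2 nu : probability 'rV[R]_d R, Pp p nu &
       forall i, weak_continuity_eq (rv.1 i) (rv.2 i) nu (mu i))].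

Definition action (p : R) rho v : \bar R :=
  (\int[lebesgue_measure]_(t in `[0%R, 1%R])
     \sum_(i < N) \int[rho i t]_x (enorm (v i t x) `^ p)%:E)%E.

Definition dynamic_value (p : R) mu : \bar R :=
  ereal_inf [set action p rv.1 rv.2 | rv in admissible p mu].

End transport.

(* Main.v *)
(* C <= DC. Given an admissible family with common initial measure nu, cut R^d
   into small cells y_k and a cell at infinity. By linear programming duality a
   discrete plan of cost at most V exists as soon as V bounds
   sum_i sum_k a_i(k) mu_i(cell k) for all potentials with
   sum_i a_i(k_i) <= cost(y_k). Extend each a_i backwards in time by the
   Hopf-Lax formula, smoothed to phi_i in C_c^1: then
   dt phi_i + grad phi_i . w <= |w|^p, so testing the continuity equation gives
   int phi_i(1) dmu_i - int phi_i(0) dnu <= int int |v_i|^p drho_i dt, while the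
   dual constraint gives sum_i phi_i(0, z) <= 0 for every z. Compactness of
   plans is avoided: the discrete plan is realised by a coupling that is a
   mixture of products of conditioned marginals, with cost close to DC.

   DC <= C. Given a coupling gamma and a measurable near-minimiser z(x) of
   sum_i |x_i - z|^p, move x_i along t |-> z(x) + t (x_i - z(x)). With rho^i_t
   the law of the moving point under gamma and v^i the conditional expectation
   of the velocity x_i - z(x) given (time, position), the continuity equation
   is the chain rule integrated against gamma, and Jensen's inequality bounds
   the action by the integral of sum_i |x_i - z(x)|^p. *)
From HB Require Import structures.
Require Import Defs.
From mathcomp Require Import all_boot all_order all_algebra.
From mathcomp Require Import all_classical all_reals all_analysis measurable_realfun.
From mathcomp Require Import ring lra.
Import Order.TTheory GRing.Theory Num.Theory.
Import numFieldNormedType.Exports.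
Local Open Scope classical_set_scope.
Local Open Scope ring_scope.
Set Implicit Arguments.
Unset Strict Implicit.

(** * Linear programming duality *)

(** For an arbitrary admissible family, measurability in time of the inner integrals is not
    established. In the bound C <= DC integrals are therefore handled as suprema over simple
    functions: monotonicity and superadditivity survive and both point the right way. Test functions
    need compact support, which dual potentials do not provide: subtracting from each potential its
    value at infinity and taking a smooth maximum with 0 repairs this, and the subtracted constants
    cancel between times 0 and 1. A Hopf-Lax cone with apex at time 1 is singular there, so the apex
    is delayed to time 1 + e; this multiplies the dual cost by (1 + e)^(1 - p) and leaves an error
    e^(1 - p) (h^2 + eta)^(p/2) per marginal, where h is the cell size. Hence the order of choices:
    the delay, then the radius of the region cut into cells, then h; the delay is removed only at
    the very end. For DC <= C, time is a uniform random variable, so that one conditional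
    expectation on a product space gives a velocity field jointly Borel in time and space. *)

Lemma farkas_seq (R : realFieldType) (I T : finType) (s : seq T)
    (b : I -> R) (l : T -> I -> R) : uniq s ->
  (forall x : I -> R, (forall t, t \in s -> \sum_i l t i * x i <= 0) ->
     \sum_i b i * x i <= 0) ->
  exists2 c : T -> R, (forall t, 0 <= c t) &
    forall i, b i = \sum_(t <- s) c t * l t i.
Proof.
(* Induction on the list of constraints, projecting one of them away. With no constraint left,
   testing the hypothesis at [x = b] forces [b = 0]. *)
elim: s b l => [|t0 s IH] b l /=.
  move=> _ H; exists (fun=> 0) => // i.
  have b0 : \sum_i b i ^+ 2 = 0.
    apply/eqP; rewrite eq_le; apply/andP; split; last first.
      by apply: sumr_ge0 => j _; exact: sqr_ge0.
    by rewrite (le_trans _ (H b _))//; under eq_bigr do rewrite expr2.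
  rewrite big_nil; apply/eqP; rewrite -sqrf_eq0; apply/eqP.
  by apply: (psumr_eq0P _ b0) => // j _; exact: sqr_ge0.
case/andP=> t0s us H.
(* Either [t0] is redundant and gets coefficient 0, or some [x0] obeys the constraints of [s] with
   [b . x0 > 0]; the hypothesis then forces [l t0 . x0 > 0]. *)
have [H'|] := pselect (forall x : I -> R,
    (forall t, t \in s -> \sum_i l t i * x i <= 0) -> \sum_i b i * x i <= 0).
  have [c c0 cE] := IH _ _ us H'.
  exists (fun t => if t == t0 then 0 else c t).
    by move=> t; case: ifP.
  move=> i; rewrite big_cons eqxx mul0r add0r cE; apply: eq_big_seq => t ts.
  by case: eqP => // tt0; rewrite -tt0 ts in t0s.
move=> /existsNP[x0 /not_implyP[lx0 /negP]]; rewrite -ltNge => bx0.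
pose y0 := \sum_i l t0 i * x0 i.
have y0_gt0 : 0 < y0.
  rewrite ltNge; apply/negP => y00; move: bx0; rewrite ltNge => /negP; apply.
  by apply: H => t; rewrite inE => /orP[/eqP ->|/lx0].
pose x1 i := x0 i / y0.
have x1E (f : I -> R) : \sum_i f i * x1 i = (\sum_i f i * x0 i) / y0.
  by rewrite mulr_suml; apply: eq_bigr => i _; rewrite mulrA.
pose v (f : I -> R) := \sum_i f i * x1 i.
have vt0 : v (l t0) = 1 by rewrite /v x1E divff// gt_eqF.
have vb : 0 < v b by rewrite /v x1E divr_gt0.
have vs t : t \in s -> v (l t) <= 0.
  by move=> /lx0 h; rewrite /v x1E pmulr_lle0// invr_gt0.
(* [proj] is the adjoint of the projection along [x1] onto the kernel of [l t0]; the induction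
   hypothesis is applied to the projected functionals. *)
pose proj (f : I -> R) i := f i - v f * l t0 i.
have projE (f x : I -> R) : \sum_i proj f i * x i =
    \sum_i f i * (x i - (\sum_i l t0 i * x i) * x1 i).
  rewrite /proj.
  transitivity (\sum_i f i * x i - v f * (\sum_i l t0 i * x i)).
    rewrite mulr_sumr -sumrB; apply: eq_bigr => i _; ring.
  rewrite mulrC mulr_sumr -sumrB; apply: eq_bigr => i _; ring.
have [|c c0 cE] := IH (proj b) (fun t => proj (l t)) us.
  move=> x hx; rewrite projE; apply: H => t; rewrite inE => /orP[/eqP ->|ts].
    by rewrite -projE /proj vt0; under eq_bigr do rewrite mul1r subrr mul0r; rewrite big1.
  by rewrite -projE; exact: hx.
(* Undoing the projection fixes the coefficient of [t0]; it is nonnegative since [v b > 0] while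
   [v (l t) <= 0] for [t] in [s]. *)
exists (fun t => if t == t0 then v b - \sum_(t <- s) c t * v (l t) else c t).
  move=> t; case: ifP => // _; rewrite subr_ge0 (le_trans _ (ltW vb))//.
  rewrite big_seq; apply: sumr_le0 => u us'.
  by rewrite mulr_ge0_le0// vs.
move=> i; rewrite big_cons eqxx.
have -> : b i = proj b i + v b * l t0 i by rewrite /proj subrK.
rewrite cE mulrBl addrC -addrA; congr (_ + _).
rewrite mulr_suml addrC -sumrB.
apply: eq_big_seq => t ts.
have -> : (t == t0) = false by apply/eqP => tt0; rewrite -tt0 ts in t0s.
by rewrite /proj mulrBr mulrA.
Qed.

Lemma farkas (R : realFieldType) (I T : finType) (b : I -> R) (l : T -> I -> R) :
  (forall x : I -> R, (forall t, \sum_i l t i * x i <= 0) ->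
     \sum_i b i * x i <= 0) ->
  exists2 c : T -> R, (forall t, 0 <= c t) & forall i, b i = \sum_t c t * l t i.
Proof.
move=> H; apply: (@farkas_seq R I T (index_enum T)) => [|x hx].
  exact: index_enum_uniq.
by apply: H => t; apply: hx; rewrite mem_index_enum.
Qed.

(* Kantorovich duality on a finite set; in the proof the index [inr _] carries
   the cost, which turns the inhomogeneous system into a cone. *)
Lemma transport_duality (R : realFieldType) (N : nat) (K : finType)
    (m : 'I_N -> K -> R) (C : {ffun 'I_N -> K} -> R) (V : R) :
  (forall k, 0 <= C k) ->
  (forall a : 'I_N -> K -> R, (forall k : {ffun 'I_N -> K}, \sum_i a i (k i) <= C k) ->
     \sum_i \sum_k a i k * m i k <= V) ->
  exists w : {ffun 'I_N -> K} -> R,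
    [/\ forall k, 0 <= w k,
        forall i x, \sum_(k : {ffun 'I_N -> K} | k i == x) w k = m i x &
        \sum_k w k * C k <= V].
Proof.
move=> C0 H.
pose l (t : {ffun 'I_N -> K} + 'I_1) (i : ('I_N * K) + 'I_1) : R :=
  match t, i with
  | inl k, inl (i, x) => (k i == x)%:R
  | inl k, inr _ => - C k
  | inr _, inl _ => 0
  | inr _, inr _ => -1
  end.
pose b (i : ('I_N * K) + 'I_1) : R :=
  match i with inl (i, x) => m i x | inr _ => - V end.
have lE k (x : ('I_N * K) + 'I_1 -> R) :
    \sum_i l (inl k) i * x i = \sum_i x (inl (i, k i)) - C k * x (inr ord0).
  rewrite big_sumType/= big_ord1 mulNr; congr (_ - _).
  transitivity (\sum_i \sum_y (k i == y)%:R * x (inl (i, y))).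
    by rewrite pair_bigA; apply: eq_bigr => -[].
  apply: eq_bigr => i _; rewrite (bigD1 (k i))//= eqxx mul1r big1 ?addr0// => y.
  by rewrite eq_sym => /negbTE ->; rewrite mul0r.
have bE (x : ('I_N * K) + 'I_1 -> R) :
    \sum_i b i * x i = \sum_i \sum_y x (inl (i, y)) * m i y - V * x (inr ord0).
  rewrite big_sumType/= big_ord1 mulNr; congr (_ - _).
  rewrite pair_bigA/=; apply: eq_bigr => -[i y] _ /=; exact: mulrC.
have [|w w0 wE] := @farkas _ _ _ b l.
  move=> x hx.
  have s0 : 0 <= x (inr ord0).
    have := hx (inr ord0).
    by rewrite big_sumType/= big_ord1 big1 ?add0r ?mulN1r ?oppr_le0// => ? _; rewrite mul0r.
  have hk (k : {ffun 'I_N -> K}) : \sum_i x (inl (i, k i)) <= C k * x (inr ord0).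
    by have := hx (inl k); rewrite lE subr_le0.
  rewrite bE subr_le0.
  (* The multiplier [x (inr ord0)] may vanish, so the potentials are divided by [x (inr ord0) + e];
     the dual constraint persists because [C] is nonnegative. Then [e] tends to 0. *)
  have key (e : R) : 0 < e -> \sum_i \sum_y x (inl (i, y)) * m i y <= V * (x (inr ord0) + e).
    move=> e0; have xe : 0 < x (inr ord0) + e by rewrite ltr_wpDl.
    rewrite -ler_pdivrMr//.
    rewrite mulr_suml.
    apply: le_trans (H (fun i y => x (inl (i, y)) / (x (inr ord0) + e)) _).
      by apply: ler_sum => i _; rewrite mulr_suml; apply: ler_sum => y _; rewrite mulrAC.
    move=> k; rewrite -mulr_suml ler_pdivrMr// (le_trans (hk k))//.
    by rewrite ler_wpM2l// lerDl ltW.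
  have V0 : 0 <= V.
    apply: le_trans (H (fun _ _ => 0) _); last by move=> k; rewrite big1.
    by rewrite big1// => i _; rewrite big1// => y _; rewrite mul0r.
  apply/ler_addgt0Pr => e e0.
  have V1 : 0 < V + 1 by rewrite ltr_wpDl.
  rewrite (le_trans (key (e / (V + 1)) _))// ?divr_gt0//.
  rewrite mulrDr lerD2l mulrA ler_pdivrMr// mulrDr mulr1 mulrC.
  by rewrite lerDl ltW.
exists (fun k => w (inl k)); split => //.
  move=> i x; rewrite -[RHS]/(b (inl (i, x))) wE big_sumType/= big_ord1/= mulr0 addr0.
  rewrite big_mkcond/=; apply: eq_bigr => k _.
  by case: eqP => //= _; rewrite (mulr1, mulr0).
(* At the cost index the equation says that [V] is the cost of the plan plus a slack, the
   coefficient of [inr ord0]. *)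
have := wE (inr ord0); rewrite /b/= big_sumType/= big_ord1/= mulrN1 => h.
rewrite -[V]opprK h opprD opprK -sumrN ler_wpDr//.
by apply: ler_sum => k _; rewrite mulrN opprK.
Qed.

(** * Smooth Hamilton-Jacobi subsolutions *)

Section C1_functions.
Context {R : realType} {V : normedModType R}.
Implicit Types f g : V -> R.

(** Phrased through directional derivatives so as to coincide with the first two clauses of
    [Cc1]. *)
Definition C1 f := (forall z, differentiable f z) /\
  forall w, continuous (fun z => 'D_w f z).

Lemma C1_derivable f z w : C1 f -> derivable f z w.
Proof. by case=> + _ => /(_ z)/diff_derivable. Qed.

Lemma C1_continuous f : C1 f -> continuous f.
Proof. by case=> df _ z; exact/differentiable_continuous/df. Qed.

Lemma C1_cst (a : R) : C1 (fun=> a).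
Proof.
split=> [z|w z]; first exact: differentiable_cst.
rewrite (_ : 'D_w _ = cst 0); first exact: cst_continuous.
by apply/funext => y /=; exact: derive_cst.
Qed.

Lemma C1D f g : C1 f -> C1 g -> C1 (fun z => f z + g z).
Proof.
move=> f1 g1; have [df cf] := f1; have [dg cg] := g1.
split=> [z|w z]; first exact: differentiableD.
rewrite (_ : 'D_w _ = (fun y => 'D_w f y + 'D_w g y)).
  by apply: cvgD; [exact: cf|exact: cg].
by apply/funext => y /=; rewrite deriveD//; exact: C1_derivable.
Qed.

Lemma C1M f g : C1 f -> C1 g -> C1 (fun z => f z * g z).
Proof.
move=> f1 g1; have [df cf] := f1; have [dg cg] := g1.
split=> [z|w z]; first exact: differentiableM.
rewrite (_ : 'D_w _ = (fun y => f y * 'D_w g y + g y * 'D_w f y)).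
  by apply: cvgD; apply: cvgM; try exact: C1_continuous; [exact: cg|exact: cf].
by apply/funext => y /=; rewrite deriveM//; exact: C1_derivable.
Qed.

Lemma derive_comp1 f (G : R -> R) (dG : R) z w :
  differentiable f z -> is_derive (f z) 1 G dG ->
  'D_w (fun y => G (f y)) z = dG * 'D_w f z.
Proof.
move=> df [dGz dGE].
have dG' : differentiable G (f z) by exact/derivable1_diffP.
rewrite deriveE; last exact: differentiable_comp.
rewrite -[fun y => G (f y)]/(G \o f) diff_comp//= deriv1E//.
by rewrite derive1E dGE -deriveE// mulrC.
Qed.

Lemma C1_comp f (G dG : R -> R) : C1 f ->
  (forall z, is_derive (f z) 1 G (dG (f z))) ->
  (forall z, {for f z, continuous dG}) -> C1 (fun z => G (f z)).
Proof.
move=> f1 GdG cdG; have [df cf] := f1; split=> [z|w z].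
  apply: differentiable_comp => //; apply/derivable1_diffP.
  by have [] := GdG z.
rewrite (_ : 'D_w _ = (fun y => dG (f y) * 'D_w f y)).
  apply: cvgM; last exact: cf.
  by apply: continuous_comp; [exact: C1_continuous|exact: cdG].
by apply/funext => y /=; exact: derive_comp1.
Qed.

Lemma C1B f g : C1 f -> C1 g -> C1 (fun z => f z - g z).
Proof.
move=> f1 g1; apply: C1D => //.
rewrite (_ : (fun z => - g z) = (fun z => (-1) * g z)).
  by apply: C1M => //; exact: C1_cst.
by apply/funext => z; rewrite mulN1r.
Qed.

Lemma C1_sum (I : Type) (s : seq I) (F : I -> V -> R) :
  (forall i, C1 (F i)) -> C1 (fun z => \sum_(i <- s) F i z).
Proof.
move=> F1; elim: s => [|i s IH].
  under eq_fun do rewrite big_nil; exact: C1_cst.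
by under eq_fun do rewrite big_cons; exact: C1D.
Qed.

Lemma C1_powR f (q : R) :
  C1 f -> (forall z : V, 0 < f z) -> C1 (fun z => f z `^ q).
Proof.
move=> f1 f0; apply: (@C1_comp f (fun s => s `^ q) (fun s => q * s `^ (q - 1))) => //.
  by move=> z; exact: is_derive1_powR.
move=> z; apply: cvgM; first exact: cvg_cst.
have c : {for f z, continuous (fun s => s `^ (q - 1))}.
  apply: differentiable_continuous; apply/derivable1_diffP.
  by have [] := is_derive1_powR (q - 1) (f0 z).
exact: c.
Qed.

End C1_functions.

Section smooth_max.
Context {R : realType}.
Implicit Types s e : R.

Lemma is_derive_sqr_pos s :
  is_derive s 1 (fun s => Num.max s 0 ^+ 2) (2 * Num.max s 0).
Proof.
have [s0|s0|->] := ltgtP s 0.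
- apply: (@near_eq_is_derive _ _ _ (cst 0)) => //.
    near=> y; rewrite /cst max_r ?expr0n// ltW//.
    by near: y; exact: lt_nbhsl.
  by rewrite mulr0; exact: is_derive_cst.
- apply: (@near_eq_is_derive _ R R (fun y : R => y ^+ 2)) => //.
    near=> y; rewrite max_l// ltW//.
    by near: y; exact: lt_nbhsr.
  apply: is_derive_eq.
  by rewrite -[s%:A]/(s * 1); ring.
(* At the kink the difference quotient is at most [|h|] in absolute value. *)
- rewrite mulr0.
  have lim0 : (fun h : R => h^-1 *: ((Num.max (h *: 1 + 0 : R) 0 ^+ 2) - Num.max (0:R) 0 ^+ 2)) @ 0^' --> (0 : R).
    apply/cvgrPdist_lt => e e0; near=> h.
    rewrite sub0r normrN maxxx expr0n subr0 addr0 [h *: 1]mulr1.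
    have h0 : h != 0 by near: h; exact: nbhs_dnbhs_neq.
    apply: (@le_lt_trans _ _ `|h|).
      have [h'|h'] := leP h 0; first by rewrite expr0n/= scaler0 normr0.
      by rewrite expr2 scalerA mulVf// scale1r.
    near: h; apply: dnbhs0_lt; exact: e0.
  split.
    by apply/cvg_ex; exists 0.
  exact/cvg_lim.
Unshelve. all: by end_near. Qed.

(* A C^1 version of [max s 0], below it by at most [e / 2]. *)
Definition spos e s := (Num.max s 0 ^+ 2 - Num.max (s - e) 0 ^+ 2) / (2 * e).
Definition dspos e s := (Num.max s 0 - Num.max (s - e) 0) / e.

Lemma is_derive_spos e s : 0 < e -> is_derive s 1 (spos e) (dspos e s).
Proof.
move=> e0.
have h2 : is_derive s 1 (fun s => Num.max (s - e) 0 ^+ 2) (2 * Num.max (s - e) 0).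
  have ds := is_derive_sqr_pos (s - e); have [d1 d2] := ds.
  have D : is_derive s 1 (fun s : R => s - e) 1.
    by apply: is_derive_eq; rewrite subr0.
  have df : differentiable (fun s : R => s - e) s.
    by apply/derivable1_diffP; exact: ex_derive.
  split.
    apply/derivable1_diffP.
    apply: (@differentiable_comp _ _ _ _ (fun s : R => s - e) (fun s => Num.max s 0 ^+ 2)) => //.
    exact/derivable1_diffP.
  by apply: etrans (derive_comp1 _ df ds) _; rewrite derive_val mulr1.
have h1 := is_derive_sqr_pos s.
rewrite (_ : spos e = (2 * e)^-1 \*: ((fun s => Num.max s 0 ^+ 2) - (fun s => Num.max (s - e) 0 ^+ 2))).
  apply: is_derive_eq; rewrite /dspos -mulrBr scalerA/=.
  by rewrite -[_ *: _]/(_ * _); field; rewrite gt_eqF.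
by apply/funext => y; rewrite /spos/= mulrC.
Qed.

Lemma dspos_continuous e : continuous (dspos e).
Proof.
move=> s; apply: cvgM; last exact: cvg_cst.
apply: cvgB.
  by apply: (@continuous_max _ _ id (cst 0)); [exact: cvg_id|exact: cvg_cst].
apply: (@continuous_max _ _ (fun s => s - e) (cst 0)); last exact: cvg_cst.
by apply: cvgB; [exact: cvg_id|exact: cvg_cst].
Qed.

(** Slopes in [0, 1] make the derivative of [g + spos e (f - g)] a convex combination of those of
    [f] and [g]; [derive_smax_le] rests on this. *)
Lemma dspos_ge0_le1 e s : 0 < e -> 0 <= dspos e s <= 1.
Proof.
move=> e0; rewrite /dspos ler_pdivrMr// mul1r pmulr_lge0 ?invr_gt0// subr_ge0.
by apply/andP; split; case: (leP s 0) => ?; case: (leP (s - e) 0) => ?; lra.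
Qed.

Lemma spos_bounds e s : 0 < e ->
  [/\ Num.max s 0 - e / 2 <= spos e s, spos e s <= Num.max s 0 & 0 <= spos e s].
Proof.
move=> e0; rewrite /spos ler_pdivlMr ?mulr_gt0// ler_pdivrMr ?mulr_gt0//.
rewrite pmulr_lge0 ?invr_gt0 ?mulr_gt0//.
by split; case: (leP s 0) => ?; case: (leP (s - e) 0) => ?; nra.
Qed.

Lemma spos_le0 e s : s <= 0 -> 0 < e -> spos e s = 0.
Proof.
by move=> s0 e0; rewrite /spos !max_r ?subrr ?mul0r//; lra.
Qed.

Lemma spos_ge e s : 0 < e -> e <= s -> spos e s = s - e / 2.
Proof.
move=> e0 s0; rewrite /spos !max_l; [|lra|lra].
by field; rewrite gt_eqF.
Qed.

Lemma dspos_ge e s : 0 < e -> e <= s -> dspos e s = 1.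
Proof.
move=> e0 s0; rewrite /dspos !max_l; [|lra|lra].
by field; rewrite gt_eqF.
Qed.

End smooth_max.

Section euclidean_norm.
Context {R : realType} {d : nat}.
Implicit Types x y z : 'rV[R]_d.

Lemma dotpC x y : dotp x y = dotp y x.
Proof. by apply: eq_bigr => j _; rewrite mulrC. Qed.

Lemma dotpDl x y z : dotp (x + y) z = dotp x z + dotp y z.
Proof. by rewrite -big_split; apply: eq_bigr => j _; rewrite mxE mulrDl. Qed.

Lemma dotpZl (a : R) x z : dotp (a *: x) z = a * dotp x z.
Proof. by rewrite mulr_sumr; apply: eq_bigr => j _; rewrite mxE mulrA. Qed.

Lemma dotpNl x z : dotp (- x) z = - dotp x z.
Proof. by rewrite -scaleN1r dotpZl mulN1r. Qed.

Lemma dotp_ge0 x : 0 <= dotp x x.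
Proof. by apply: sumr_ge0 => j _; rewrite -expr2 sqr_ge0. Qed.

Lemma enorm_ge0 x : 0 <= enorm x.
Proof. exact: sqrtr_ge0. Qed.

Lemma sqr_enorm x : enorm x ^+ 2 = dotp x x.
Proof. by rewrite sqr_sqrtr// dotp_ge0. Qed.

Lemma enormN x : enorm (- x) = enorm x.
Proof. by rewrite /enorm dotpNl dotpC dotpNl opprK. Qed.

Lemma enormB x y : enorm (x - y) = enorm (y - x).
Proof. by rewrite -opprB enormN. Qed.

Lemma enormZ (a : R) x : enorm (a *: x) = `|a| * enorm x.
Proof.
by rewrite /enorm dotpZl dotpC dotpZl mulrA -expr2 sqrtrM ?sqr_ge0// sqrtr_sqr.
Qed.

Lemma enorm0 : enorm (0 : 'rV[R]_d) = 0.
Proof. by rewrite -(scale0r (0 : 'rV[R]_d)) enormZ normr0 mul0r. Qed.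

Lemma coord_le_enorm x j : `|x ord0 j| <= enorm x.
Proof.
rewrite -sqrtr_sqr ler_wsqrtr// /dotp (bigD1 j)//= expr2 lerDl.
by apply: sumr_ge0 => k _; rewrite -expr2 sqr_ge0.
Qed.

Lemma enorm_eq0 x : enorm x = 0 -> x = 0.
Proof.
move=> x0; apply/rowP => j; rewrite mxE; apply/eqP; rewrite -normr_le0 -x0.
exact: coord_le_enorm.
Qed.

(** Cauchy-Schwarz, by expanding the nonnegative square of [enorm y *: x - enorm x *: y]. *)
Lemma dotp_le_enorm x y : dotp x y <= enorm x * enorm y.
Proof.
have [a0|a_neq0] := eqVneq (enorm x) 0.
  by rewrite (enorm_eq0 a0) enorm0 mul0r /dotp big1// => j _; rewrite mxE mul0r.
have [b0|b_neq0] := eqVneq (enorm y) 0.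
  by rewrite dotpC (enorm_eq0 b0) enorm0 mulr0 /dotp big1// => j _; rewrite mxE mul0r.
have a0 : 0 < enorm x by rewrite lt_def a_neq0 enorm_ge0.
have b0 : 0 < enorm y by rewrite lt_def b_neq0 enorm_ge0.
have := dotp_ge0 (enorm y *: x + (- enorm x) *: y).
rewrite dotpDl !dotpZl ![dotp _ (_ + _)]dotpC !dotpDl !dotpZl [dotp y x]dotpC -!sqr_enorm.
move: a0 b0; set a := enorm x; set b := enorm y; set c := dotp x y => a0 b0 h.
have ab0 : 0 < a * b by rewrite mulr_gt0.
rewrite -subr_ge0 -(pmulr_rge0 _ ab0); nra.
Qed.

Lemma enorm_triangle x y : enorm (x + y) <= enorm x + enorm y.
Proof.
rewrite -ler_sqr ?nnegrE ?addr_ge0 ?enorm_ge0// sqr_enorm.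
rewrite dotpDl ![dotp _ (_ + _)]dotpC !dotpDl [dotp y x]dotpC -!sqr_enorm.
have := dotp_le_enorm x y; nra.
Qed.

Lemma enorm_continuous : continuous (@enorm R d).
Proof.
move=> x; apply: continuous_comp; last exact: sqrt_continuous.
apply: continuous_big => [|j _ y]; first exact: add_continuous.
by apply: (@cvgM _ _ (nbhs y)); exact: (@coord_continuous R 1 d ord0 j y).
Qed.

End euclidean_norm.

Section powR_inequalities.
Context {R : realType}.
Implicit Types (p a b s u w : R).

Lemma powR_sqr a p : 0 <= a -> (a ^+ 2) `^ (p / 2) = a `^ p.
Proof. by move=> a0; rewrite -powR_mulrn// -powRrM; congr (_ `^ _); field. Qed.

(** Convexity of the power at [a / (1 - s)] and [b / s] with weights [1 - s] and [s]. The factor of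
    [a] tends to 1 with [s], so replacing a point by a nearby cell centre costs little. *)
Lemma powR_weighted_triangle p s a b : 1 < p -> 0 < s -> s < 1 -> 0 <= a -> 0 <= b ->
  (a + b) `^ p <= (1 - s) `^ (1 - p) * a `^ p + s `^ (1 - p) * b `^ p.
Proof.
move=> p1 s0 s1 a0 b0.
have s1' : 0 < 1 - s by rewrite subr_gt0.
have ps : 0 <= s <= 1 by rewrite !ltW.
have scale (r c : R) : 0 < r -> 0 <= c -> r * (c / r) `^ p = r `^ (1 - p) * c `^ p.
  move=> r0 c0; rewrite powRM// ?invr_ge0 ?ltW// mulrCA [RHS]mulrC; congr (_ * _).
  by rewrite [RHS]powRD ?powRr1 ?ltW// ?(gt_eqF r0) ?implybT// -powR_inv1 ?ltW// -powRrM mulN1r.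
have h1 : b / s \in `[0, +oo[%classic by rewrite inE/= in_itv/= andbT divr_ge0// ltW.
have h2 : a / (1 - s) \in `[0, +oo[%classic by rewrite inE/= in_itv/= andbT divr_ge0// ltW.
have H : (s * (b / s) + (1 - s) * (a / (1 - s))) `^ p <=
    s * (b / s) `^ p + (1 - s) * (a / (1 - s)) `^ p :=
  @convex_powR R p (ltW p1) (Itv01 (ltW s0) (ltW s1)) _ _ h1 h2.
rewrite !scale// in H; rewrite addrC [leRHS]addrC (le_trans _ H)//.
by rewrite le_eqVlt; apply/orP; left; apply/eqP; congr (_ `^ _); field; rewrite !gt_eqF.
Qed.

(** The tangent of the convex function [w^p] at [u], obtained from Young's inequality with exponents
    [p / (p - 1)] and [p]. It serves both the cones and the Jensen bound. *)
Lemma young_powR p u w : 1 < p -> 0 <= u -> 0 <= w ->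
  p * u `^ (p - 1) * w <= (p - 1) * u `^ p + w `^ p.
Proof.
move=> p1 u0 w0; have p0 : 0 < p by lra.
have q0 : 0 < p - 1 by lra.
have := @conjugate_powR R (u `^ (p - 1)) w (p / (p - 1)) p (powR_ge0 _ _) w0.
rewrite divr_gt0// => /(_ isT p0).
rewrite -powRrM mulrCA divff ?gt_eqF// mulr1 => h.
rewrite -mulrA mulrC -ler_pdivlMr//; apply: le_trans (h _) _.
  by field; rewrite !gt_eqF.
rewrite le_eqVlt; apply/orP; left; apply/eqP; field.
by rewrite !gt_eqF.
Qed.

End powR_inequalities.

Section directional.
Context {R : realType} {d : nat}.
Implicit Types (z w : R * 'rV[R]_d) (x : 'rV[R]_d).

Lemma differentiable_fst z : differentiable (fst : (R * 'rV[R]_d)%type -> R^o) z.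
Proof. by apply: linear_differentiable => y; exact: cvg_fst. Qed.

Lemma differentiable_snd z : differentiable (snd : (R * 'rV[R]_d)%type -> 'rV[R]_d) z.
Proof. by apply: linear_differentiable => y; exact: cvg_snd. Qed.

Lemma derive_fst z w : 'D_w (fst : (R * 'rV[R]_d)%type -> R^o) z = w.1.
Proof.
rewrite deriveE; last exact: differentiable_fst.
by rewrite diff_lin// => y; exact: cvg_fst.
Qed.

Lemma C1_fst : C1 (fst : (R * 'rV[R]_d)%type -> R).
Proof.
split; first exact: differentiable_fst.
move=> w z; rewrite (_ : 'D_w _ = cst w.1); first exact: cst_continuous.
by apply/funext => y; exact: derive_fst.
Qed.

Lemma differentiable_coord2 j z : differentiable (fun z : R * 'rV[R]_d => z.2 ord0 j) z.
Proof.
apply: (@differentiable_comp _ _ _ _ snd (fun x : 'rV[R]_d => x ord0 j)).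
  exact: differentiable_snd.
exact: differentiable_coord.
Qed.

Lemma derive_coord2 j z w : 'D_w (fun z : R * 'rV[R]_d => z.2 ord0 j) z = w.2 ord0 j.
Proof.
have @f : {linear (R * 'rV[R]_d)%type -> R}.
  by exists (fun z : R * 'rV[R]_d => z.2 ord0 j); do 2![eexists]; do ?[constructor];
     rewrite ?mxE// => ? *; rewrite ?mxE//; move=> ?; rewrite !mxE.
rewrite deriveE; last exact: differentiable_coord2.
rewrite (_ : (fun _ => _) = f)// diff_lin//.
by move=> y; exact/differentiable_continuous/differentiable_coord2.
Qed.

Lemma C1_coord2 j : C1 (fun z : R * 'rV[R]_d => z.2 ord0 j).
Proof.
split; first exact: differentiable_coord2.
move=> w z; rewrite (_ : 'D_w _ = cst (w.2 ord0 j)); first exact: cst_continuous.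
by apply/funext => y; exact: derive_coord2.
Qed.

(** The integrand of the weak equation is one derivative, along [(1, v)]; subsolutions and straight
    paths are both treated in this form. *)
Lemma derive_dt_gradx (phi : R * 'rV[R]_d -> R) t x v : differentiable phi (t, x) ->
  'D_((1, v) : R * 'rV[R]_d) phi (t, x) = dt phi (t, x) + dotp (gradx phi (t, x)) v.
Proof.
move=> dphi; rewrite /dt /dotp deriveE//.
have -> : ((1, v) : R * 'rV[R]_d) =
    (1, 0) + \sum_(j < d) v ord0 j *: ((0, delta_mx ord0 j) : R * 'rV[R]_d).
  apply/pair_equal_spec; rewrite /=; split.
    rewrite -[LHS]addr0; congr (_ + _); apply/esym.
    by rewrite (big_morph fst (id1 := 0) (op1 := +%R))// big1// => j _ /=; rewrite scaler0.
  rewrite add0r (big_morph snd (id1 := 0) (op1 := +%R))//= {1}(row_sum_delta v).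
  by [].
rewrite linearD linear_sum/= deriveE//; congr (_ + _).
apply: eq_bigr => j _; rewrite linearZ/= mxE deriveE// mulrC.
by [].
Qed.

End directional.

Section subsolutions.
Context {R : realType} {d : nat}.
Implicit Types (z w : R * 'rV[R]_d) (x y : 'rV[R]_d) (e p a eta t : R).

(* [1 + e - t] for [t <= 1], continued to a positive C^1 function on [R]. *)
Definition clock e t := e / 2 + spos e (1 + e - t).

Lemma clock_gt0 e t : 0 < e -> 0 < clock e t.
Proof. by move=> e0; rewrite ltr_pwDl ?divr_gt0//; have [] := spos_bounds (1 + e - t) e0. Qed.

Lemma clockE e t : 0 < e -> t <= 1 -> clock e t = 1 + e - t.
Proof. by move=> e0 t1; rewrite /clock spos_ge//; lra. Qed.

Definition sqdist eta y z := dotp (y - z.2) (y - z.2) + eta.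

Lemma sqdist_gt0 eta y z : 0 < eta -> 0 < sqdist eta y z.
Proof. by move=> eta0; rewrite ltr_wpDl// dotp_ge0. Qed.

(* The backward Hopf-Lax cone with apex [y] at time [1 + e], smoothed at its axis. *)
Definition cone p e eta a y z :=
  a - clock e z.1 `^ (1 - p) * sqdist eta y z `^ (p / 2).

Lemma C1_clock e : 0 < e -> C1 (fun z => clock e z.1).
Proof.
move=> e0; apply: C1D; first exact: C1_cst.
apply: (@C1_comp _ _ (fun z => 1 + e - z.1) (spos e) (dspos e)).
- by apply: C1B; [exact: C1_cst|exact: C1_fst].
- by move=> z; exact: is_derive_spos.
- by move=> z; exact: dspos_continuous.
Qed.

Lemma derive_clock e z w : 0 < e -> z.1 <= 1 ->
  'D_w (fun z => clock e z.1) z = - w.1.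
Proof.
move=> e0 z1; rewrite deriveD; last 2 first.
- exact: derivable_cst.
- apply: C1_derivable; apply: (@C1_comp _ _ (fun z => 1 + e - z.1) (spos e) (dspos e)).
  + by apply: C1B; [exact: C1_cst|exact: C1_fst].
  + by move=> y; exact: is_derive_spos.
  + by move=> y; exact: dspos_continuous.
have dl : C1 (fun z => 1 + e - z.1) by apply: C1B; [exact: C1_cst|exact: C1_fst].
rewrite derive_cst add0r (derive_comp1 _ (dl.1 z) (is_derive_spos _ e0)).
rewrite dspos_ge ?mul1r; [|lra|lra].
rewrite deriveB; [|exact: derivable_cst|exact: C1_derivable C1_fst].
by rewrite derive_cst sub0r derive_fst.
Qed.

Lemma C1_sqdist eta y : C1 (sqdist eta y).
Proof.
apply: C1D; last exact: C1_cst.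
rewrite (_ : (fun z => _) = (fun z => \sum_(j <- enum 'I_d)
    (y ord0 j - z.2 ord0 j) * (y ord0 j - z.2 ord0 j))).
  by apply: C1_sum => j; apply: C1M; apply: C1B; (exact: C1_cst || exact: C1_coord2).
by apply/funext => z; rewrite big_enum/=; apply: eq_bigr => j _; rewrite !mxE.
Qed.

Lemma derive_sqdist eta y z w : 'D_w (sqdist eta y) z = - 2 * dotp (y - z.2) w.2.
Proof.
pose h j z := (y ord0 j - z.2 ord0 j) * (y ord0 j - z.2 ord0 j).
have hE j : C1 (fun z => y ord0 j - z.2 ord0 j).
  by apply: C1B; [exact: C1_cst|exact: C1_coord2].
have h1 j : C1 (h j) by exact: C1M.
have hd j : 'D_w (h j) z = - 2 * ((y ord0 j - z.2 ord0 j) * w.2 ord0 j).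
  rewrite /h deriveM; try exact: C1_derivable (hE j).
  rewrite deriveB; [|exact: derivable_cst|exact: C1_derivable (C1_coord2 j)].
  rewrite derive_cst derive_coord2 sub0r -[_ *: _]/(_ * _); ring.
rewrite (_ : sqdist eta y = (\sum_(j < d) h j) + cst eta); last first.
  apply/funext => u; rewrite /sqdist /dotp/= fct_sumE; congr (_ + _).
  by apply: eq_bigr => j _; rewrite !mxE.
rewrite deriveD; [|by apply: derivable_sum => j; exact: C1_derivable|exact: derivable_cst].
rewrite derive_cst addr0 derive_sum; last by move=> j; exact: C1_derivable.
rewrite mulr_sumr; apply: eq_bigr => j _.
by rewrite hd !mxE.
Qed.

Lemma C1_cone p e eta a y : 0 < e -> 0 < eta -> C1 (cone p e eta a y).
Proof.
move=> e0 eta0; apply: C1B; first exact: C1_cst.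
apply: C1M; apply: C1_powR.
- exact: C1_clock.
- by move=> z; exact: clock_gt0.
- exact: C1_sqdist.
- by move=> z; exact: sqdist_gt0.
Qed.

(* Young's inequality with [u = sqrt (sqdist) / clock]. *)
Lemma cone_subsolution p e eta a y z v : 1 < p -> 0 < e -> 0 < eta -> z.1 <= 1 ->
  'D_((1, v) : R * 'rV[R]_d) (cone p e eta a y) z <= enorm v `^ p.
Proof.
move=> p1 e0 eta0 z1.
have ck := C1_clock e0; have sq := C1_sqdist eta y.
have ck0 z' := @clock_gt0 e z'.1 e0; have sq0 z' := @sqdist_gt0 eta y z' eta0.
have ckp := C1_powR (1 - p) ck ck0; have sqp := C1_powR (p / 2) sq sq0.
rewrite deriveB; [|exact: derivable_cst|exact: C1_derivable (C1M ckp sqp)].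
rewrite derive_cst sub0r deriveM; [|exact: C1_derivable ckp|exact: C1_derivable sqp].
rewrite (derive_comp1 _ (ck.1 z) (is_derive1_powR (1 - p) (ck0 z))).
rewrite (derive_comp1 _ (sq.1 z) (is_derive1_powR (p / 2) (sq0 z))).
rewrite derive_clock// derive_sqdist/= -![_ *: _]/(_ * _).
(* The derivative is now [p g^(1-p) q^(p/2-1) b - (p-1) g^(-p) q^(p/2)], and [b] is controlled by
   Cauchy-Schwarz. *)
set g := clock e z.1; set q := sqdist eta y z; set b := dotp _ _.
have g0 : 0 < g := ck0 z; have q0 : 0 < q := sq0 z.
have bq : b <= q `^ (2^-1) * enorm v.
  rewrite (le_trans (dotp_le_enorm _ _))// ler_wpM2r ?enorm_ge0// powR12_sqrt ?(ltW q0)//.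
  by rewrite ler_wsqrtr// lerDl ltW.
have u0 : 0 <= q `^ 2^-1 / g by rewrite divr_ge0 ?powR_ge0 ?ltW.
have := young_powR p1 u0 (enorm_ge0 v).
have gN (r : R) : (q `^ 2^-1 / g) `^ r = q `^ (r / 2) * g `^ (- r).
  rewrite powRM ?powR_ge0 ?invr_ge0 ?(ltW g0)// -powRrM mulrC [2^-1 * r]mulrC mulrC.
  by rewrite -(powR_inv1 (ltW g0)) -powRrM mulN1r.
rewrite !gN.
have -> : 1 - p - 1 = - p by ring.
have -> : - (p - 1) = 1 - p by ring.
have -> : q `^ ((p - 1) / 2) = q `^ (p / 2 - 1) * q `^ 2^-1.
  rewrite -powRD; last by rewrite (gt_eqF q0) implybT.
  by congr (_ `^ _); field.
have k0 : 0 <= g `^ (1 - p) * q `^ (p / 2 - 1) * p.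
  by rewrite !mulr_ge0 ?powR_ge0//; lra.
have := ler_wpM2l k0 bq; nra.
Qed.

End subsolutions.

Section smooth_maximum.
Context {R : realType} {V : normedModType R} {K : eqType}.
Variables (e : R) (F : K -> V -> R).
Hypothesis e0 : 0 < e.
Implicit Types s : seq K.

(** Starting the recursion at 0 yields a smoothed maximum of 0 and the [F k], which vanishes exactly
    where all [F k] are nonpositive. This cut at 0 is the source of compact support. *)
Fixpoint smax s : V -> R :=
  if s is k :: s' then fun z => smax s' z + spos e (F k z - smax s' z) else fun=> 0.

Lemma C1_smax s : (forall k, C1 (F k)) -> C1 (smax s).
Proof.
move=> F1; elim: s => [|k s IH] /=; first exact: C1_cst.
apply: C1D => //; apply: (@C1_comp _ _ (fun z => F k z - smax s z) (spos e) (dspos e)).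
- exact: C1B.
- by move=> z; exact: is_derive_spos.
- by move=> z; exact: dspos_continuous.
Qed.

Lemma smax_ge0 s z : 0 <= smax s z.
Proof.
elim: s => [|k s IH] //=; rewrite addr_ge0//.
by have [] := spos_bounds (F k z - smax s z) e0.
Qed.

(** [spos] smooths from below, so the true maximum is never exceeded. *)
Lemma smax_le s z : smax s z <= 0 \/ exists2 k, k \in s & smax s z <= F k z.
Proof.
elim: s => [|k s IH] /=; first by left.
have [_ h _] := spos_bounds (F k z - smax s z) e0.
have [Fs|sF] := leP (F k z) (smax s z); last first.
  right; exists k; first by rewrite mem_head.
  by rewrite max_l in h; lra.
have {}h : smax s z + spos e (F k z - smax s z) <= smax s z.
  by rewrite max_r in h; lra.
case: IH => [s0|[k' k's sk]]; first by left; exact: le_trans s0.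
by right; exists k'; [rewrite inE k's orbT|exact: le_trans sk].
Qed.

(** Each smoothing step loses at most [e / 2]. *)
Lemma smax_ge s z k : k \in s -> F k z - (size s)%:R * (e / 2) <= smax s z.
Proof.
elim: s => [|k' s IH] //=; rewrite inE -[(size s).+1]addn1 natrD mulrDl mul1r.
have [h _ h0] := spos_bounds (F k' z - smax s z) e0.
have sz : 0 <= (size s)%:R * (e / 2) by rewrite mulr_ge0// divr_ge0// ltW.
have e0' := e0.
case/orP => [/eqP ->|/IH {}IH]; last lra.
have : F k' z - smax s z <= Num.max (F k' z - smax s z) 0 by rewrite le_max lexx.
lra.
Qed.

Lemma smax_eq0 s z : (forall k, F k z <= 0) -> smax s z = 0.
Proof.
move=> F0; elim: s => [|k s IH] //=.
by rewrite IH add0r spos_le0// subr_le0.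
Qed.

(** Each step takes a convex combination of derivatives; [0 <= c] accounts for the base value, whose
    derivative is 0. *)
Lemma derive_smax_le s z w (c : R) : (forall k, C1 (F k)) -> 0 <= c ->
  (forall k, 'D_w (F k) z <= c) -> 'D_w (smax s) z <= c.
Proof.
move=> F1 c0 Fc; elim: s => [|k s IH] /=; first by rewrite derive_cst.
have s1 := C1_smax s F1; have d1 := C1B (F1 k) s1.
have sd := is_derive_spos (F k z - smax s z) e0.
rewrite deriveD; last 2 first.
- exact: C1_derivable.
- apply: C1_derivable; apply: (C1_comp (dG := dspos e) d1) => y.
    exact: is_derive_spos.
  exact: dspos_continuous.
rewrite (derive_comp1 _ (d1.1 z) sd) deriveB; try exact: C1_derivable.
have := @dspos_ge0_le1 R e (F k z - smax s z) e0.
by have := Fc k; move: IH; set a := 'D_w _ z; set b := 'D_w _ z; nra.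
Qed.

End smooth_maximum.

(** * Testing the continuity equation *)

Section integral_without_measurability.
Local Open Scope ereal_scope.
Context d (T : measurableType d) (R : realType) (mu : {measure set T -> \bar R}).
Implicit Types (D : set T) (f g : T -> \bar R).
Import HBNNSimple.

(** The integral of a nonnegative function is a supremum over the simple functions below it, so
    enlarging the function enlarges the family. *)
Lemma ge0_le_integralW D f g : (forall x, D x -> 0 <= f x) ->
  (forall x, D x -> f x <= g x) ->
  \int[mu]_(x in D) f x <= \int[mu]_(x in D) g x.
Proof.
move=> f0 fg; rewrite !ge0_integralE//; last first.
  by move=> x Dx; rewrite (le_trans (f0 _ Dx))// fg.
apply: ge_ereal_sup => _ [h /= hf <-]; apply: ereal_sup_ubound.
exists h => //= x; rewrite (le_trans (hf x))// /patch.
by case: ifPn => //; rewrite inE => /fg.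
Qed.

(** Dropping the negative part of [f] only increases its integral, and the positive part is still
    below [g]. *)
Lemma le_integralW D f g : (forall x, D x -> 0 <= g x) ->
  (forall x, D x -> f x <= g x) ->
  \int[mu]_(x in D) f x <= \int[mu]_(x in D) g x.
Proof.
move=> g0 fg; rewrite integralE.
apply: (@le_trans _ _ (\int[mu]_(x in D) f^\+ x)).
  by rewrite geeDl// oppe_le0 integral_ge0.
apply: ge0_le_integralW => // x Dx.
by rewrite funeposE ge_max fg//= g0.
Qed.

(** Simple functions below [f] and [g] add up to one below [f + g]. Superadditivity is the direction
    that bounds a sum of time integrals by the action. *)
Lemma ge0_integralD_geW D f g : (forall x, D x -> 0 <= f x) ->
  (forall x, D x -> 0 <= g x) ->
  \int[mu]_(x in D) f x + \int[mu]_(x in D) g x <= \int[mu]_(x in D) (f x + g x).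
Proof.
move=> f0 g0; rewrite !ge0_integralE//; last by move=> x Dx; rewrite adde_ge0 ?f0 ?g0.
pose S (h : T -> \bar R) := [set sintegral mu k | k in
  [set k : {nnsfun T >-> R} | forall x, (k x)%:E <= (h \_ D) x]].
rewrite -/(S f) -/(S g) -/(S (f \+ g)).
set A := S f; set B := S g; set C := S (f \+ g).
have in0 (h : T -> \bar R) : (forall x, D x -> 0 <= h x) ->
    S h 0.
  move=> h0; exists nnsfun0; last exact: sintegral0.
  by move=> x /=; rewrite /patch; case: ifPn => //; rewrite inE => /h0.
have A0 : A 0 by exact: in0.
have B0 : B 0 by exact: in0.
have ABC x y : A x -> B y -> C (x + y).
  move=> [h /= hf <-] [k /= kg <-]; exists (add_nnsfun h k); last exact: sintegralD.
  move=> z /=; have := leeD (hf z) (kg z); rewrite /patch -EFinD.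
  by case: ifPn => //; rewrite adde0.
have AC x : A x -> C x by move=> Ax; rewrite -[x]adde0; exact: ABC.
have BC x : B x -> C x by move=> Bx; rewrite -[x]add0e; exact: ABC.
have [->|Cy] := eqVneq (ereal_sup C) +oo; first by rewrite leey.
have fin (X : set (\bar R)) : X 0 -> X `<=` C -> ereal_sup X \is a fin_num.
  move=> X0 XC; rewrite ge0_fin_numE; last exact: ereal_sup_ubound.
  by rewrite (le_lt_trans (ereal_sup_le XC))// ltey.
have fA := fin A A0 AC; have fB := fin B B0 BC; have fC := fin C (AC _ A0) (fun x h => h).
apply/lee_addgt0Pr => e e0.
have e2 : (0 < e / 2)%R by rewrite divr_gt0.
have [x Ax xA] := ub_ereal_sup_adherent e2 fA.
have [y By yB] := ub_ereal_sup_adherent e2 fB.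
rewrite lteBlDr// in xA; rewrite lteBlDr// in yB.
rewrite (le_trans (leeD (ltW xA) (ltW yB)))// addeACA -EFinD -splitr.
by rewrite leeD2r// ereal_sup_ubound//; exact: ABC.
Qed.

Lemma ge0_integral_sum_geW (I : Type) (s : seq I) D (f : I -> T -> \bar R) :
  (forall i x, D x -> 0 <= f i x) ->
  \sum_(i <- s) \int[mu]_(x in D) f i x <= \int[mu]_(x in D) \sum_(i <- s) f i x.
Proof.
move=> f0; elim: s => [|i s IH].
  by rewrite big_nil integral_ge0// => x Dx; rewrite big_nil.
rewrite big_cons; under [X in _ <= X]eq_integral do rewrite big_cons.
apply: le_trans (leeD2l _ IH) _; apply: ge0_integralD_geW => x Dx; first exact: f0.
by apply: sume_ge0 => j _; exact: f0.
Qed.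

End integral_without_measurability.

Lemma rV_closed_enorm_ball_compact (R : realType) (d : nat) (r : R) :
  compact [set x : 'rV[R]_d | enorm x <= r].
Proof.
apply: bounded_closed_compact.
  exists r; split; first exact: num_real.
  move=> M rM x /= xr; rewrite [`|x|]mx_normrE.
  apply/bigmax_leP; split => [|[i j] _ /=].
    by rewrite (le_trans (enorm_ge0 x))// (le_trans xr)// ltW.
  by rewrite (ord1 i) (le_trans (coord_le_enorm _ _))// (le_trans xr)// ltW.
rewrite (_ : [set _ | _] = (@enorm R d) @^-1` [set y | y <= r]).
  by apply: closed_comp; [move=> x _; exact: enorm_continuous|exact: closed_le].
by [].
Qed.

Lemma weak_continuity_subsolution (R : realType) (d : nat) (p : R)
    (rho : R -> probability 'rV[R]_d R) (v : R -> 'rV[R]_d -> 'rV[R]_d)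
    (nu mu : probability 'rV[R]_d R) (phi : R * 'rV[R]_d -> R) :
  weak_continuity_eq rho v nu mu -> Cc1 phi ->
  (forall t x w, 0 <= t <= 1 ->
     'D_((1, w) : R * 'rV[R]_d) phi (t, x) <= enorm w `^ p) ->
  (\int[mu]_x (phi (1%R, x))%:E - \int[nu]_x (phi (0%R, x))%:E <=
   \int[lebesgue_measure]_(t in `[0%R, 1%R])
      \int[rho t]_x (enorm (v t x) `^ p)%:E)%E.
Proof.
move=> wce phi1 sub; rewrite -(wce _ phi1); apply: le_integralW => t.
  by move=> _; apply: integral_ge0 => x _; rewrite lee_fin powR_ge0.
rewrite /= in_itv/= => t01; apply: le_integralW => x _; first by rewrite lee_fin powR_ge0.
have [dphi _ _] := phi1.
by rewrite lee_fin -derive_dt_gradx; [exact: sub|exact: dphi].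
Qed.

Section dual_bound.
Context {R : realType} {d n : nat}.
Variables (p e eta : R) (y : 'I_n -> 'rV[R]_d).
Hypotheses (p1 : 1 < p) (e0 : 0 < e) (eta0 : 0 < eta).

(** A smooth stand-in for the backward Hopf-Lax evolution [max(0, max_k (b k - |y k - x|^p / (1 + e
    - t)^(p - 1)))]. *)
Definition dual_test (eps : R) (b : 'I_n -> R) : R * 'rV[R]_d -> R :=
  smax eps (fun k => cone p e eta (b k) (y k)) (enum 'I_n).

Lemma Cc1_dual_test (eps : R) b : 0 < eps -> Cc1 (dual_test eps b).
Proof.
move=> eps0.
have [c1 c2] : C1 (dual_test eps b) by apply: C1_smax => // k; exact: C1_cone.
split=> //; have p1' := p1; have eta0' := eta0; have e0' := e0.
pose M := \sum_k `|b k|; pose c := (1 + e) `^ (1 - p).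
have c0 : 0 < c by rewrite powR_gt0// addr_gt0.
(* For [t] in [0, 1] the clock is at most [1 + e], so each cone is below [M - c |y k - x|^p], which
   is nonpositive beyond this radius. *)
pose r := (M / c) `^ p^-1 + \sum_k enorm (y k).
exists [set x : 'rV[R]_d | enorm x <= r]; first exact: rV_closed_enorm_ball_compact.
move=> t x /andP[t0 t1] /= /negP; rewrite -ltNge => rx.
apply: smax_eq0 => // k; rewrite /cone/= subr_le0.
have M0 : 0 <= M by exact: sumr_ge0.
have bM : b k <= M.
  by rewrite (le_trans (ler_norm _))// /M (bigD1 k)//= lerDl sumr_ge0.
rewrite (le_trans bM)//.
have yx : (M / c) `^ p^-1 <= enorm (y k - x).
  have yk : enorm (y k) <= \sum_k enorm (y k).
    by rewrite (bigD1 k)//= lerDl; apply: sumr_ge0 => j _; exact: enorm_ge0.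
  have := enorm_triangle (x - y k) (y k); rewrite subrK enormB.
  by move: rx; rewrite /r; lra.
have Mc0 : 0 <= M / c by rewrite divr_ge0// ltW.
apply: (@le_trans _ _ (c * enorm (y k - x) `^ p)).
  rewrite mulrC -ler_pdivrMr// -[leLHS]powRr1// -(@mulVf _ p); last by rewrite gt_eqF//; lra.
  rewrite powRrM ge0_ler_powR ?nnegrE ?powR_ge0 ?enorm_ge0//; lra.
apply: ler_pM; rewrite ?powR_ge0//.
- rewrite /c clockE// -[X in X `^ _]invrK -[leRHS]/(_ `^ _).
  have ck : 0 < 1 + e - t by lra.
  rewrite -!(opprB p 1) !powRN lef_pV2 ?posrE ?powR_gt0 ?invr_gt0 ?invrK//; [|lra..].
  by rewrite ge0_ler_powR ?nnegrE//; lra.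
- rewrite /sqdist.
  rewrite -(powR_sqr p (enorm_ge0 _)) sqr_enorm.
  by rewrite ge0_ler_powR ?nnegrE ?addr_ge0 ?dotp_ge0//; lra.
Qed.

Lemma dual_test_subsolution (eps : R) b (t : R) x w : 0 < eps -> 0 <= t <= 1 ->
  'D_((1, w) : R * 'rV[R]_d) (dual_test eps b) (t, x) <= enorm w `^ p.
Proof.
move=> eps0 /andP[_ t1]; apply: derive_smax_le => // [k||k]; [exact: C1_cone|exact: powR_ge0|exact: cone_subsolution].
Qed.

(** The clock reads [1 + e] at time 0, and [eta] only lowers a cone. The first alternative will be
    charged to the point at infinity, whose distance counts for 0. *)
Lemma dual_test0_le (eps : R) b x : 0 < eps ->
  dual_test eps b (0, x) <= 0 \/
  exists k, dual_test eps b (0, x) <= b k - (1 + e) `^ (1 - p) * enorm (y k - x) `^ p.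
Proof.
move=> eps0; have [h|[k _ h]] :=
  smax_le (fun k => cone p e eta (b k) (y k)) eps0 (enum 'I_n) (0, x); [by left|right].
exists k; rewrite (le_trans h)// /cone/= clockE// subr0 lerB// ler_wpM2l ?powR_ge0//.
rewrite -(powR_sqr p (enorm_ge0 _)) sqr_enorm.
have p1' := p1; rewrite /sqdist/= ge0_ler_powR ?nnegrE ?dotp_ge0//; first lra.
  by rewrite addr_ge0 ?dotp_ge0 ?ltW.
by rewrite lerDl ltW.
Qed.

(** The clock reads [e] at time 1, and the [n] smoothing steps cost [eps / 2] each. *)
Lemma dual_test1_ge (eps : R) b x k : 0 < eps ->
  b k - e `^ (1 - p) * (enorm (y k - x) ^+ 2 + eta) `^ (p / 2) - n%:R * (eps / 2) <=
  dual_test eps b (1, x).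
Proof.
move=> eps0; have := smax_ge (fun k => cone p e eta (b k) (y k)) eps0 (1, x)
  (_ : k \in enum 'I_n); rewrite mem_enum => /(_ isT).
by rewrite size_enum_ord /cone/= clockE// /sqdist/= -sqr_enorm (addrC 1) addrK.
Qed.

End dual_bound.

(** * Borel measurability on matrix spaces *)

Section borel_matrices.
Context {R : realType}.

Lemma open_measurable_mx m n (U : set 'M[R]_(m, n)) : open U -> measurable U.
Proof. by move=> oU; exact: sub_sigma_algebra. Qed.

Lemma rat_mx_approx m n (x : 'M[R]_(m, n)) (e : R) : 0 < e ->
  exists q : 'M[rat]_(m, n), ball (map_mx ratr q : 'M[R]_(m, n)) e x.
Proof.
move=> e0; have P i j : exists q : rat, ratr q \in `]x i j - e, x i j + e[.
  by apply: rat_in_itvoo; rewrite ltrD2l gtrN.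
exists (\matrix_(i, j) xchoose (P i j)); split=> // i j.
rewrite !mxE; have := xchooseP (P i j); rewrite in_itv/= /ball/=.
by rewrite distrC ltr_distlC.
Qed.

(** Open sets are countable unions of balls with rational centres, and a ball of the sup norm is a
    product of intervals, one for each entry. *)
Lemma measurable_fun_mx d (T : measurableType d) m n (D : set T)
    (f : T -> 'M[R]_(m, n)) : measurable D ->
  (forall i j, measurable_fun D (fun x => f x i j)) -> measurable_fun D f.
Proof.
move=> mD mf; apply: (@measurability _ _ _ _ D f (open : set (set 'M[R]_(m, n)))) => //.
move=> _ [U oU <-].
(* [B] enumerates the balls inside [U] with rational centre [q] and radius [1 / (r + 1)]; every
   other code gives the empty set. *)
pose B k : set 'M[R]_(m, n) := if unpickle k is Some (q, r) then
        if pselect (ball (map_mx ratr q : 'M[R]_(m, n)) (r.+1%:R^-1 : R) `<=` U) then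
          ball (map_mx ratr (q : 'M[rat]_(m, n)) : 'M[R]_(m, n)) (r.+1%:R^-1 : R) else set0 else set0.
have -> : U = \bigcup_k B k.
  apply/seteqP; split => [x Ux|x [k _]]; rewrite /B; last first.
    by case: unpickle => [[q r]|//]; case: pselect => h //=; exact: h.
  move: oU; rewrite openE => /(_ _ Ux); rewrite /interior -nbhs_ballE => -[e/= e0 xU].
  (* Twice the radius stays below [e]: the ball around [q] has to contain [x] and remain in the
     [e]-ball around [x]. *)
  have [r rP] : exists r : nat, 2 * r.+1%:R^-1 < e.
    have e2 : 0 < e / 2 by rewrite divr_gt0.
    have [r rP] := ltr_add_invr e2.
    by exists r; move: rP; rewrite add0r ltr_pdivlMr// mulrC.
  have r0 : (0 : R) < r.+1%:R^-1 by rewrite invr_gt0.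
  have [q qx] := rat_mx_approx x r0.
  exists (pickle (q, r)) => //; rewrite pickleK; case: pselect => // -[].
  move=> z qz; apply: xU; apply: le_ball (ltW rP) _ _.
  by rewrite mulr_natl mulr2n; apply: ball_triangle (ball_sym qx) qz.
rewrite preimage_bigcup setI_bigcupr; apply: bigcup_measurable => k _.
rewrite /B; case: unpickle => [[q r]|]; last by rewrite preimage_set0 setI0.
case: pselect => ? /=; last by rewrite preimage_set0 setI0.
rewrite (_ : _ `&` _ = D `&` \bigcap_(ij in [set: 'I_m * 'I_n])
   (D `&` (fun x => f x ij.1 ij.2) @^-1` (ball (ratr (q ij.1 ij.2) : R) (r.+1%:R^-1 : R)))).
  apply: measurableI => //; apply: fin_bigcap_measurable; first exact: finite_finset.
  move=> ij _; apply: mf => //; apply: open_measurable; exact: ball_open.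
apply/seteqP; split => x /=.
  move=> [Dx [_ fx]]; split=> // ij _; split => //=.
  by have := fx ij.1 ij.2; rewrite mxE.
move=> [Dx h]; split=> //; split=> [|i j]; first by rewrite invr_gt0.
by rewrite mxE; have [] := h (i, j) I.
Qed.

Lemma continuous_measurable_mx m n (f : 'M[R]_(m, n) -> R) :
  continuous f -> measurable_fun setT f.
Proof.
move=> cf; apply: (measurability _ (RGenOInfty.measurableE R)).
move=> _ [_ [a ->] <-]; rewrite setTI; apply: open_measurable_mx.
by apply: open_comp => [x _|]; [exact: cf|exact: interval_open].
Qed.

Lemma measurable_mx_coord m n i j : measurable_fun setT (fun x : 'M[R]_(m, n) => x i j).
Proof.
apply: continuous_measurable_mx; exact: coord_continuous.
Qed.

(* The product sigma-algebra on [R * 'rV_d] is Borel: transport along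
   the homeomorphism with ['rV_(1 + d)]. *)
Lemma continuous_measurable_prod d (f : R * 'rV[R]_d -> R) :
  continuous f -> measurable_fun setT f.
Proof.
move=> cf.
pose g (y : 'rV[R]_(1 + d)) : R * 'rV[R]_d := (y ord0 ord0, rsubmx y).
pose h (z : R * 'rV[R]_d) : 'rV[R]_(1 + d) := row_mx (const_mx z.1) z.2.
have gh z : g (h z) = z.
  rewrite /g /h row_mxKr; case: z => t x /=; congr (_, _).
  by rewrite (_ : ord0 = lshift d ord0 :> 'I_(1 + d)) ?row_mxEl ?mxE//; exact: val_inj.
rewrite (_ : f = (f \o g) \o h); last by apply/funext => z /=; rewrite gh.
apply: measurableT_comp.
  apply: continuous_measurable_mx => y; apply: continuous_comp; last exact: cf.
  have c1 : continuous (fun y : 'rV[R]_(1 + d) => y ord0 ord0) by exact: coord_continuous.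
  have c2 : continuous (@rsubmx R 1 1 d) by exact: continuous_rsubmx.
  exact: (cvg_pair (c1 y) (c2 y)).
apply: measurable_fun_mx => // i j; rewrite (ord1 i).
case: (split_ordP j) => k ->.
  under eq_fun do rewrite row_mxEl mxE; exact: measurable_fst.
under eq_fun do rewrite row_mxEr.
by apply: (measurableT_comp (measurable_mx_coord ord0 k)); exact: measurable_snd.
Qed.

Lemma measurable_row N d i : measurable_fun setT (fun x : 'M[R]_(N, d) => row i x).
Proof.
apply: measurable_fun_mx => // a j; under eq_fun do rewrite mxE.
exact: measurable_mx_coord.
Qed.

Lemma measurable_enorm d (dT : measure_display) (T : measurableType dT)
    (f : T -> 'rV[R]_d) D : measurable_fun D f -> measurable_fun D (fun x => enorm (f x)).
Proof.
move=> mf; apply: (measurable_comp (F := setT)) => //.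
by apply: continuous_measurable_mx; exact: enorm_continuous.
Qed.

End borel_matrices.

Section bounded_integrals.
Context d (T : measurableType d) (R : realType) (P : probability T R).

Lemma bounded_integrable (f : T -> R) (M : R) : measurable_fun setT f ->
  (forall x, `|f x| <= M) -> P.-integrable setT (EFin \o f).
Proof.
move=> mf fM; apply: measurable_bounded_integrable => //.
  by rewrite -ge0_fin_numE// fin_num_measure.
exists M; split; first exact: num_real.
by move=> x Mx y _ /=; rewrite (le_trans (fM y))// ltW.
Qed.

Lemma measurable_fun_finite (K : finType) (Q : T -> K) (f : K -> R) :
  (forall k, measurable (Q @^-1` [set k])) -> measurable_fun setT (fun x => f (Q x)).
Proof.
move=> mQ.
rewrite (_ : (fun _ => _) = (fun x => \sum_k f k * \1_(Q @^-1` [set k]) x)).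
  apply: measurable_sum => k; exact: measurable_funM.
apply/funext => x; rewrite (bigD1 (Q x))//= indicE mem_set// mulr1 big1 ?addr0//.
by move=> k kQ; rewrite indicE memNset ?mulr0//= => Qk; rewrite Qk eqxx in kQ.
Qed.

Lemma integral_finite (K : finType) (Q : T -> K) (f : K -> R) :
  (forall k, measurable (Q @^-1` [set k])) ->
  (\int[P]_x (f (Q x))%:E = (\sum_k f k * fine (P (Q @^-1` [set k])))%:E)%E.
Proof.
move=> mQ.
transitivity (\int[P]_x \sum_k (f k * \1_(Q @^-1` [set k]) x)%:E)%E.
  apply: eq_integral => x _; rewrite sumEFin; congr (_%:E).
  rewrite (bigD1 (Q x))//= indicE mem_set// mulr1 big1 ?addr0//.
  by move=> k kQ; rewrite indicE memNset ?mulr0//= => Qk; rewrite Qk eqxx in kQ.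
rewrite integral_sum//; last first.
  move=> k; apply: (@bounded_integrable _ `|f k|).
    exact: measurable_funM.
  by move=> x; rewrite normrM ler_piMr// indicE; case: (_ \in _); rewrite ?normr1 ?normr0.
rewrite -sumEFin; apply: eq_bigr => k _.
under eq_integral do rewrite EFinM.
rewrite integralZl//; last first.
  apply: (@bounded_integrable _ 1) => //.
  by move=> x; rewrite indicE; case: (_ \in _); rewrite ?normr1 ?normr0.
by rewrite integral_indic// setIT EFinM fineK// fin_num_measure.
Qed.

End bounded_integrals.

(** * Dual values bounded by the action *)

Section transport_value_bound.
Context {R : realType} {d N n : nat}.
Variables (p h : R) (y : 'I_n -> 'rV[R]_d) (Q : 'rV[R]_d -> option 'I_n).
Hypotheses (p1 : 1 < p) (mQ : forall k, measurable (Q @^-1` [set k])).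
Hypothesis Qh : forall x k, Q x = Some k -> enorm (y k - x) <= h.

(* The index [None] stands for a point at infinity, whose distance to any [z] counts for 0. *)
Definition partial_cost (k : {ffun 'I_N -> option 'I_n}) (z : 'rV[R]_d) : R :=
  \sum_i (if k i is Some j then enorm (y j - z) `^ p else 0).

Definition cell_cost k : R := inf [set partial_cost k z | z in [set: 'rV[R]_d]].

Lemma partial_cost_ge0 k z : 0 <= partial_cost k z.
Proof. by apply: sumr_ge0 => i _; case: (k i) => // j; rewrite powR_ge0. Qed.

Lemma cell_cost_has_inf k : has_inf [set partial_cost k z | z in [set: 'rV[R]_d]].
Proof.
split; first by exists (partial_cost k 0), 0.
by exists 0 => _ [z _ <-]; exact: partial_cost_ge0.
Qed.

Lemma cell_cost_le k z : cell_cost k <= partial_cost k z.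
Proof. by apply: ge_inf; [case: (cell_cost_has_inf k)|exists z]. Qed.

Lemma cell_cost_ge0 k : 0 <= cell_cost k.
Proof.
apply: lb_le_inf; first by exists (partial_cost k 0), 0.
by move=> _ [z _ <-]; exact: partial_cost_ge0.
Qed.

Variables (mu : 'I_N -> probability 'rV[R]_d R) (nu : probability 'rV[R]_d R)
  (rho : 'I_N -> R -> probability 'rV[R]_d R) (v : 'I_N -> R -> 'rV[R]_d -> 'rV[R]_d).
Hypothesis wce : forall i, weak_continuity_eq (rho i) (v i) nu (mu i).

(** The factor [(1 + e)^(1 - p)] in the constraint is the price of the delayed apex, seen at time 0.
    The error term bounds, for each marginal, the drop at time 1 of a cone at distance at most [h]
    from its axis. *)
Lemma dual_value_le_action (e eta A : R) (a : 'I_N -> option 'I_n -> R) :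
  0 < e -> 0 < eta -> action p rho v = A%:E ->
  (forall k : {ffun 'I_N -> option 'I_n},
     \sum_i a i (k i) <= (1 + e) `^ (1 - p) * cell_cost k) ->
  \sum_i \sum_k a i k * fine (mu i (Q @^-1` [set k])) <=
    A + N%:R * (e `^ (1 - p) * (h ^+ 2 + eta) `^ (p / 2)).
Proof.
move=> e0 eta0 AE acost.
have p1' := p1.
set D := e `^ (1 - p) * _.
have D0 : 0 <= D by rewrite mulr_ge0 ?powR_ge0.
apply/ler_addgt0Pr => eps' eps'0.
(* The [N] test functions lose at most [n * eps / 2] each, so less than [eps'] in total; [+ 1] keeps
   the denominator positive. *)
pose eps := eps' / (N%:R * n%:R + 1).
have Nn0 : (0 : R) < N%:R * n%:R + 1 by rewrite ltr_wpDl// mulr_ge0.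
have eps0 : 0 < eps by rewrite divr_gt0.
(* Normalised to the value 0 on the cell at infinity, as compact support demands. *)
pose b i k := a i (Some k) - a i None.
pose phi i := dual_test p e eta y eps (b i).
have phi1 i : Cc1 (phi i) by exact: Cc1_dual_test.
have phic i (t : R) : continuous (fun x => phi i (t, x)).
  move=> x; apply: (@continuous_comp _ _ _ (fun x : 'rV[R]_d => (t, x)) (phi i)).
    apply: differentiable_continuous; apply: differentiable_pair; first exact: differentiable_cst.
    exact: ex_diff.
  by apply: differentiable_continuous; have [dphi _ _] := phi1 i; exact: dphi.
have phim i (t : R) := continuous_measurable_mx (phic i t).
have phi_ge0 i z : 0 <= phi i z by exact: smax_ge0.
pose M := \sum_i \sum_k `|b i k|.
have M0 : 0 <= M by apply: sumr_ge0 => i _; exact: sumr_ge0.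
have bM i k : `|b i k| <= M.
  rewrite /M (bigD1 i)//= (bigD1 k)//= -addrA lerDl addr_ge0//; first exact: sumr_ge0.
  by apply: sumr_ge0 => j _; exact: sumr_ge0.
have phi_le i z : `|phi i z| <= M.
  rewrite ger0_norm//; have [h0|[k _ hk]] :=
    smax_le (fun k => cone p e eta (b i k) (y k)) eps0 (enum 'I_n) z.
    exact: le_trans M0.
  rewrite (le_trans hk)// (le_trans _ (bM i k))// (le_trans _ (ler_norm _))//.
  by rewrite /cone gerBl mulr_ge0 ?powR_ge0.
have int (P : probability 'rV[R]_d R) i (t : R) :
    P.-integrable setT (EFin \o (fun x => phi i (t, x))).
  by apply: (@bounded_integrable _ _ _ _ _ (M)).
have fin (P : probability 'rV[R]_d R) i (t : R) : (\int[P]_x (phi i (t, x))%:E)%E \is a fin_num.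
  exact: integrable_fin_num (int P i t).
pose alpha i := fine (\int[mu i]_x (phi i (1, x))%:E)%E.
pose beta i := fine (\int[nu]_x (phi i (0, x))%:E)%E.
have upper : \sum_i (alpha i - beta i) <= A.
  rewrite -lee_fin -AE -sumEFin /action.
  apply: le_trans (ge0_integral_sum_geW _ _ _) => /=; last first.
    by move=> i t _; apply: integral_ge0 => x _; rewrite lee_fin powR_ge0.
  apply: lee_sum => i _; rewrite EFinB /alpha /beta !fineK//.
  apply: (weak_continuity_subsolution (wce i)) => // t x w t01.
  exact: dual_test_subsolution.
(* With this constant [a i (Q x) - c i] lies below [phi i (1, x)] everywhere: by [dual_test1_ge] on
   the cell of a centre, by [phi i >= 0] on the cell at infinity. *)
pose c i := a i None + D + n%:R * (eps / 2).
have sum1 i : \sum_k fine (mu i (Q @^-1` [set k])) = 1.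
  apply: EFin_inj; rewrite -[RHS](_ : (\int[mu i]_x 1%:E)%E = _); last first.
    by rewrite integral_cst// mul1e; exact: probability_setT.
  rewrite (integral_finite (mu i) (fun=> 1) mQ); congr (_%:E).
  by apply: eq_bigr => k _; rewrite mul1r.
have lower i : \sum_k a i k * fine (mu i (Q @^-1` [set k])) - c i <= alpha i.
  have -> : \sum_k a i k * fine (mu i (Q @^-1` [set k])) - c i =
      Rintegral (mu i) setT (fun x => a i (Q x) - c i).
    rewrite /Rintegral (integral_finite (mu i) (fun k => a i k - c i) mQ)/=.
    under [RHS]eq_bigr do rewrite mulrBl.
    by rewrite sumrB -mulr_sumr sum1 mulr1.
  apply: le_Rintegral => //.
  - have mg := measurable_fun_finite (fun k => a i k - c i) mQ.
    apply: (@bounded_integrable _ _ _ _ _ (\sum_k `|a i k - c i|)) => // x.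
    by rewrite (bigD1 (Q x))//= lerDl; exact: sumr_ge0.
  - exact: int.
  - move=> x _; rewrite /c; case Qx: (Q x) => [k|].
      have := dual_test1_ge p eta y e0 (b i) x k eps0.
      rewrite -/(phi i) /b.
      have : e `^ (1 - p) * (enorm (y k - x) ^+ 2 + eta) `^ (p / 2) <= D.
        rewrite /D ler_wpM2l ?powR_ge0// ge0_ler_powR ?nnegrE ?addr_ge0 ?sqr_ge0 ?(ltW eta0)//.
          by lra.
        rewrite lerD2r lerXn2r ?nnegrE ?enorm_ge0//; last exact: Qh.
        by rewrite (le_trans (enorm_ge0 _) (Qh Qx)).
      by lra.
    have := phi_ge0 i (1, x); have : 0 <= n%:R * (eps / 2) by rewrite mulr_ge0// divr_ge0// ltW.
    by lra.
have ubeta : \sum_i beta i <= - \sum_i a i None.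
  have -> : \sum_i beta i = Rintegral nu setT (fun x => \sum_i phi i (0, x)).
    apply: EFin_inj; rewrite -sumEFin /Rintegral fineK.
      under [RHS]eq_integral do rewrite -sumEFin.
      rewrite integral_sum//; last by move=> i; exact: int.
      by apply: eq_bigr => i _; rewrite fineK.
    under eq_integral do rewrite -sumEFin.
    rewrite integral_sum//; last by move=> i; exact: int.
    by apply/sum_fin_numP => i _ _; exact: fin.
  have -> : - \sum_i a i None = Rintegral nu setT (fun=> - \sum_i a i None).
    by rewrite Rintegral_cst// [X in fine X](probability_setT nu) mulr1.
  apply: le_Rintegral => //.
  - rewrite (_ : _ \o _ = (fun x => \sum_i (phi i (0, x))%:E)%E).
      by apply: integrable_sum => // i _; exact: int.
    by apply/funext => x /=; rewrite -sumEFin.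
  - by apply: (@bounded_integrable _ _ _ _ _ (`|- \sum_i a i None|)).
  - move=> x _.
    (* Each [phi i (0, x)] is bounded through one cell [k i], taken to be [None] when it is
       nonpositive. The dual constraint at these cells, with [cell_cost] bounded by the partial cost
       at the common point [x], controls the sum. *)
    have /choice[k kP] : forall i, exists k, phi i (0, x) <=
        a i k - a i None - (1 + e) `^ (1 - p) *
          (if k is Some j then enorm (y j - x) `^ p else 0).
      move=> i.
      have [h0|[j hj]] := dual_test0_le y p1 e0 eta0 (b i) x eps0.
        by exists None; rewrite mulr0 subr0 subrr.
      by exists (Some j).
    apply: le_trans (ler_sum _ (fun i _ => kP i)) _.
    rewrite !sumrB -mulr_sumr.
    have := acost [ffun i => k i]; under eq_bigr do rewrite ffunE.
    have := ler_wpM2l (powR_ge0 (1 + e) (1 - p)) (cell_cost_le [ffun i => k i] x).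
    have -> : partial_cost [ffun i => k i] x =
        \sum_(i < N) (if k i is Some j then enorm (y j - x) `^ p else 0).
      by apply: eq_bigr => i _; rewrite ffunE.
    by lra.
have sumc (r : R) : \sum_(i < N) r = N%:R * r.
  by rewrite sumr_const card_ord mulr_natl.
have csum : \sum_i c i = \sum_i a i None + N%:R * D + N%:R * (n%:R * (eps / 2)).
  by rewrite -!sumc -!big_split.
have sumlower : \sum_i \sum_k a i k * fine (mu i (Q @^-1` [set k])) - \sum_i c i <=
    \sum_i alpha i.
  by rewrite -sumrB; apply: ler_sum => i _; exact: lower.
rewrite sumrB in upper.
have small : N%:R * (n%:R * (eps / 2)) <= eps'.
  have -> : N%:R * (n%:R * (eps / 2)) = N%:R * n%:R / (N%:R * n%:R + 1) * (eps' / 2).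
    by rewrite /eps; field; rewrite gt_eqF.
  have r1 : N%:R * n%:R / (N%:R * n%:R + 1) <= 1 :> R by rewrite ler_pdivrMr// mul1r lerDl.
  rewrite (le_trans (ler_wpM2r _ r1))// ?divr_ge0 ?(ltW eps'0)// mul1r; lra.
move: sumlower upper ubeta small; rewrite csum; clear; lra.
Qed.

End transport_value_bound.

(** * Couplings from discrete plans *)

Section laws.
Context {R : realType} {d d' : measure_display} {T : measurableType d} {T' : measurableType d'}.

Definition law (P : probability T R) (f : T -> T') (mf : measurable_fun setT f) :
    probability T' R :=
  let X : {mfun T >-> T'} := HB.pack f (isMeasurableFun.Build _ _ _ _ f mf) in
  distribution P X.

Lemma lawE P f (mf : measurable_fun setT f) A : law P mf A = P (f @^-1` A).
Proof. by []. Qed.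

Lemma mixture_exists (K : finType) (w : K -> R) (P : K -> probability T R) :
  (forall k, 0 <= w k) -> \sum_k w k = 1 ->
  exists Q : probability T R, forall A, Q A = (\sum_k (w k)%:E * P k A)%E.
Proof.
move=> w0 w1.
(* Weights summing to 1 exclude an empty [K]; [k0] is the default when [K] is enumerated by natural
   numbers. *)
have k0 : K.
  case: (pickP (@predT K)) => [k _ //|K0].
  by move: w1; rewrite big1 => [/esym/eqP|k _]; [rewrite oner_eq0|have := K0 k].
pose m (j : nat) : {measure set T -> \bar R} :=
  mscale (NngNum (w0 (nth k0 (enum K) j))) (P (nth k0 (enum K) j)).
pose M : {measure set T -> \bar R} := msum m #|K|.
have ME A : M A = (\sum_k (w k)%:E * P k A)%E.
  by rewrite -big_enum/= (big_nth k0) big_mkord -cardE.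
have M1 : M setT = 1%E.
  rewrite ME; under eq_bigr do rewrite probability_setT mule1.
  by rewrite sumEFin w1.
pose Q : probability T R := HB.pack (msum m #|K|) (Measure_isProbability.Build _ _ _ (msum m #|K|) M1).
by exists Q => A; rewrite -ME.
Qed.

Lemma measure_finite_partition (P : probability T R) (K : finType) (Q : T -> K) A :
  (forall k, measurable (Q @^-1` [set k])) -> measurable A ->
  P A = (\sum_k P (A `&` Q @^-1` [set k]))%E.
Proof.
move=> mQ mA.
have mAQ k : measurable (A `&` Q @^-1` [set k]) by exact: measurableI.
transitivity (\int[P]_x \sum_k (\1_(A `&` Q @^-1` [set k]) x)%:E)%E.
  transitivity (\int[P]_x (\1_A x)%:E)%E; first by rewrite integral_indic// setIT.
  apply: eq_integral => x _; rewrite sumEFin; congr (_%:E).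
  rewrite (bigD1 (Q x))//= big1 ?addr0.
    by rewrite !indicE in_setI [X in _ && X]mem_set ?andbT.
  move=> k kQ; rewrite indicE in_setI [X in _ && X]memNset ?andbF//=.
  by move=> Qk; rewrite Qk eqxx in kQ.
rewrite integral_sum//.
  by apply: eq_bigr => k _; rewrite integral_indic// setIT.
move=> k; apply: (@bounded_integrable _ _ _ _ _ 1).
  exact: measurable_indic.
by move=> x; rewrite indicE; case: (_ \in _); rewrite ?normr1 ?normr0.
Qed.

Lemma measurable_preimage_ffun (I K : finType) (Q : I -> T -> K) s :
  (forall i k, measurable (Q i @^-1` [set k])) ->
  measurable ((fun x => [ffun i => Q i x]) @^-1` [set s]).
Proof.
move=> mQ.
rewrite (_ : _ @^-1` _ = \bigcap_(i in [set: I]) (Q i @^-1` [set s i])).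
  by apply: fin_bigcap_measurable => [|i _]; [exact: finite_finset|exact: mQ].
apply/seteqP; split => x /=; first by move=> <- i _ /=; rewrite ffunE.
by move=> h; apply/ffunP => i; rewrite ffunE; exact: h.
Qed.

End laws.

Lemma measurable_preimage_finite_comp (d : measure_display) (T : measurableType d)
    (S K : finType) (Q : T -> S) (g : S -> K) k :
  (forall s, measurable (Q @^-1` [set s])) -> measurable ((g \o Q) @^-1` [set k]).
Proof.
move=> mQ.
rewrite (_ : _ @^-1` _ = \bigcup_(s in [set s | g s = k]) (Q @^-1` [set s])).
  by apply: fin_bigcup_measurable => [|s _]; [exact: finite_finset|exact: mQ].
by apply/seteqP; split => x /=; [move=> gk; exists (Q x)|move=> [s /= <- <-]].
Qed.

(** Induction on [N]: the product of the first law with the product of the others is pushed forward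
    by stacking rows. Only values on boxes enter later. *)
Lemma product_probability_mx (R : realType) (d N : nat) (P : 'I_N -> probability 'rV[R]_d R) :
  exists G : probability 'M[R]_(N, d) R, forall A : 'I_N -> set 'rV[R]_d,
    (forall i, measurable (A i)) ->
    G [set x | forall i, A i (row i x)] = (\prod_i fine (P i (A i)))%:E.
Proof.
elim: N P => [|N IH] P.
  pose G : probability 'M[R]_(0, d) R := dirac (0 : 'M[R]_(0, d)).
  exists G => A mA; rewrite big_ord0 -(probability_setT G).
  by congr (G _); apply/seteqP; split => // x _ [].
have [G GE] := IH (fun i => P (lift ord0 i)).
pose f (z : 'rV[R]_d * 'M[R]_(N, d)) : 'M[R]_(1 + N, d) := col_mx z.1 z.2.
have mf : measurable_fun setT f.
  apply: measurable_fun_mx => // i j; case: (split_ordP i) => k ->.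
    under eq_fun do rewrite /f col_mxEu.
    by apply: (measurableT_comp (measurable_mx_coord k j)); exact: measurable_fst.
  under eq_fun do rewrite /f col_mxEd.
  by apply: (measurableT_comp (measurable_mx_coord k j)); exact: measurable_snd.
exists (law (P ord0 \x G)%E mf) => A mA.
pose B : set 'M[R]_(N, d) := [set x | forall i, A (lift ord0 i) (row i x)].
have mB : measurable B.
  rewrite (_ : B = \bigcap_(i in [set: 'I_N]) ((row i) @^-1` (A (lift ord0 i)))).
    apply: fin_bigcap_measurable => [|i _]; first exact: finite_finset.
    by have := measurable_row i measurableT (mA (lift ord0 i)); rewrite setTI.
  by apply/seteqP; split => x /= h i; [move=> _; exact: h|exact: h].
rewrite lawE (_ : _ @^-1` _ = A ord0 `*` B).
  apply: etrans (product_measure1E (P ord0) G (mA ord0) mB) _.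
  rewrite [X in (_ * X)%E](GE (fun i => A (lift ord0 i)))// big_ord_recl EFinM fineK//.
  exact: fin_num_measure.
have row0 (z : 'rV[R]_d * 'M[R]_(N, d)) : row ord0 (f z) = z.1.
  apply/rowP => j; rewrite mxE; transitivity (f z (lshift N ord0) j).
    by congr (f z _ j); exact: val_inj.
  by rewrite /f col_mxEu.
have rowS (z : 'rV[R]_d * 'M[R]_(N, d)) i : row (lift ord0 i) (f z) = row i z.2.
  apply/rowP => j; rewrite mxE; transitivity (f z (rshift 1 i) j).
    by congr (f z _ j); exact: val_inj.
  by rewrite /f col_mxEd mxE.
apply/seteqP; split => z /=.
  by move=> h; split=> [|i]; [rewrite -row0|rewrite -rowS]; exact: h.
move=> [h0 hS] i; case: (unliftP ord0 i) => [j ->|->]; first by rewrite rowS.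
by rewrite row0.
Qed.

Section plans.
Context {R : realType} {d N : nat} {K : finType}.
Variables (mu : 'I_N -> probability 'rV[R]_d R) (Q : 'rV[R]_d -> K).
Hypotheses (N_gt0 : (0 < N)%N) (mQ : forall k, measurable (Q @^-1` [set k])).

Let mass i k : R := fine (mu i (Q @^-1` [set k])).

(** On a null cell the normalisation falls back to [mu i], so this is always a probability;
    [conditionalE] covers that case because both of its sides vanish. *)
Definition conditional i k : probability 'rV[R]_d R := mnormalize (mrestr (mu i) (mQ k)) (mu i).

Lemma conditionalE i k A : measurable A ->
  mass i k * fine (conditional i k A) = fine (mu i (A `&` Q @^-1` [set k])).
Proof.
move=> mA; pose m := mu i (setT `&` Q @^-1` [set k]).
have -> : conditional i k A = (if (m == 0) || (m == +oo) then mu i A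
  else mu i (A `&` Q @^-1` [set k]) * (fine m)^-1%:E)%E.
  by rewrite /conditional /= /mnormalize /m /mrestr; case: ifP.
rewrite /m setTI.
have mAQ : measurable (A `&` Q @^-1` [set k]) by exact: measurableI.
have [m0|m0] := eqVneq (mu i (Q @^-1` [set k])) 0%E.
  rewrite /mass m0 mul0r; apply/esym.
  have : (mu i (A `&` Q @^-1` [set k]) <= 0)%E.
    by rewrite -m0 le_measure ?inE//; exact: subIsetr.
  by rewrite measure_le0 => /eqP ->.
have fm : mu i (Q @^-1` [set k]) \is a fin_num by rewrite fin_num_measure.
have -> : (mu i (Q @^-1` [set k]) == +oo)%E = false.
  by apply/negbTE; move: fm; rewrite fin_numE => /andP[].
rewrite orbF /= fineM//; last by rewrite fin_num_measure.
rewrite /mass mulrCA divff ?mulr1// fine_eq0//.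
Qed.

(** The coupling mixes, with weights [w], products of conditioned marginals. Each product of
    positive weight lives on its own box of cells, which gives the box masses; the marginal
    condition on [w] restores [mu i] cell by cell. *)
Lemma coupling_of_plan (w : {ffun 'I_N -> K} -> R) : (forall k, 0 <= w k) ->
  (forall i x, \sum_(k : {ffun 'I_N -> K} | k i == x) w k = mass i x) ->
  exists2 gamma, couplings mu gamma &
    forall k : {ffun 'I_N -> K}, gamma [set x | forall i, Q (row i x) = k i] = (w k)%:E.
Proof.
move=> w0 wm.
(* Hence a label of positive weight involves only cells of positive mass, where the conditioning is
   genuine. *)
have w_le i k : w k <= mass i (k i).
  by rewrite -wm (bigD1 k)//= lerDl; exact: sumr_ge0.
have w1 : \sum_k w k = 1.
  pose i0 := Ordinal N_gt0.
  rewrite (partition_big (fun k : {ffun 'I_N -> K} => k i0) xpredT)//=.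
  under eq_bigr do rewrite wm.
  apply: EFin_inj; rewrite -(probability_setT (mu i0)).
  rewrite [RHS](@measure_finite_partition _ _ _ (mu i0) K Q)// -sumEFin.
  by apply: eq_bigr => x _; rewrite setTI fineK// fin_num_measure.
have /choice[G GE] := fun k : {ffun 'I_N -> K} =>
  product_probability_mx (fun i => conditional i (k i)).
have [gamma gE] := @mixture_exists _ _ _ _ w G w0 w1.
exists gamma.
  move=> i A mA; rewrite /pushforward gE.
  have Gi k : G k (row i @^-1` A) = conditional i (k i) A.
    have := GE k (fun j => if j == i then A else setT) _.
    rewrite (bigD1 i)//= eqxx big1 ?mulr1 ?fineK ?fin_num_measure//; last first.
      by move=> j /negbTE ->; rewrite probability_setT.
    move=> <-; last by move=> j; case: ifP.
    congr (G k _); apply/seteqP; split => x /=.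
      by move=> Ax j; case: eqP => // ->.
    by move=> /(_ i); rewrite eqxx.
  under eq_bigr do rewrite Gi.
  rewrite (measure_finite_partition (mu i) mQ mA).
  rewrite (partition_big (fun k : {ffun 'I_N -> K} => k i) xpredT)//=.
  apply: eq_bigr => x _.
  rewrite -[RHS]fineK ?fin_num_measure//; last exact: measurableI.
  rewrite -conditionalE// EFinM -wm -sumEFin ge0_sume_distrl; last first.
    by move=> k _; rewrite lee_fin.
  by apply: eq_bigr => k /eqP <-; rewrite fineK// fin_num_measure.
move=> k0; rewrite gE (bigD1 k0)//= big1 ?adde0.
  have [-> |wk0] := eqVneq (w k0) 0; first by rewrite mul0e.
  rewrite [X in (_ * X)%E](GE k0 (fun i => Q @^-1` [set k0 i]))// big1 ?mule1// => i _.
  have m0 : mass i (k0 i) != 0.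
    by rewrite gt_eqF// (lt_le_trans _ (w_le i k0))// lt_def wk0 w0.
  by apply: (mulfI m0); rewrite conditionalE// setIid mulr1.
move=> k kk0.
have [-> |wk] := eqVneq (w k) 0; first by rewrite mul0e.
rewrite [X in (_ * X)%E](GE k (fun i => Q @^-1` [set k0 i]))//.
have [i ki] : exists i, k i != k0 i.
  apply/existsP; apply: contraNT kk0; rewrite negb_exists => /forallP h.
  by apply/eqP/ffunP => i; apply/eqP; have := h i; rewrite negbK.
rewrite (bigD1 i)//= (_ : fine (conditional _ _ _) = 0) ?mul0r ?mule0//.
have m0 : mass i (k i) != 0.
  by rewrite gt_eqF// (lt_le_trans _ (w_le i k))// lt_def wk w0.
apply: (mulfI m0); rewrite conditionalE// mulr0 (_ : _ `&` _ = set0) ?measure0//.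
apply/seteqP; split => // x [/= h1 h2]; move: ki; rewrite -h1 -h2 eqxx.
by [].
Qed.

End plans.

Lemma ge0_integral_law (R : realType) (d d' : measure_display) (T : measurableType d)
    (T' : measurableType d') (P : probability T R) (f : T -> T')
    (mf : measurable_fun setT f) (g : T' -> \bar R) :
  measurable_fun setT g -> (forall y, 0 <= g y)%E ->
  (\int[law P mf]_y g y = \int[P]_x g (f x))%E.
Proof. by move=> mg g0; rewrite /law ge0_integral_distribution. Qed.

Lemma coupling_ge0_integral (R : realType) (d N : nat) (mu : 'I_N -> probability 'rV[R]_d R)
    gamma i (g : 'rV[R]_d -> \bar R) : couplings mu gamma ->
  measurable_fun setT g -> (forall y, 0 <= g y)%E ->
  (\int[gamma]_x g (row i x) = \int[mu i]_x g x)%E.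
Proof.
move=> cg mg g0; rewrite -(ge0_integral_law gamma (measurable_row i))//.
by apply: eq_measure_integral => A mA _; exact: (cg i A mA).
Qed.

Lemma enorm_dist_continuous (R : realType) (d : nat) (c : 'rV[R]_d) :
  continuous (fun x => enorm (c - x)).
Proof.
move=> x; apply: (@continuous_comp _ _ _ (fun x => c - x) (@enorm R d)); last exact: enorm_continuous.
apply: differentiable_continuous; apply: differentiableB; first exact: differentiable_cst.
exact: ex_diff.
Qed.

(** A finite subcover of the closed ball supplies the centres, and picking one centre within [h]
    makes the cells disjoint. A point without such a centre is outside the open ball. *)
Lemma enorm_cells (R : realType) (d : nat) (r h : R) : 0 < h ->
  exists n (y : 'I_n -> 'rV[R]_d) (Q : 'rV[R]_d -> option 'I_n),
    [/\ forall k, enorm (y k) <= r,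
        forall k, measurable (Q @^-1` [set k]),
        forall x k, Q x = Some k -> enorm (y k - x) <= h &
        forall x, Q x = None -> r <= enorm x].
Proof.
move=> h0.
have := @rV_closed_enorm_ball_compact R d r; rewrite compact_cover.
move=> /(_ 'rV[R]_d [set x | enorm x <= r] (fun c => [set x | enorm (c - x) < h])).
case.
- move=> c _; rewrite (_ : [set _ | _] = (fun x => enorm (c - x)) @^-1` [set u | u < h])//.
  apply: open_comp; last exact: open_lt.
  by move=> x _; exact: enorm_dist_continuous.
- by move=> x xr; exists x => //=; rewrite subrr enorm0.
move=> D Dr cov.
pose s : seq 'rV[R]_d := finmap.enum_fset D.
pose y (k : 'I_(size s)) := nth 0 s k.
exists (size s), y, (fun x => [pick k | enorm (y k - x) <= h]); split.
- by move=> k; have := Dr _ (mem_nth 0 (ltn_ord k) : y k \in s); rewrite inE.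
- move=> k.
  (* The choice of centre factors through finitely many boolean tests, each of them measurable. *)
  pose S (x : 'rV[R]_d) := [ffun k => enorm (y k - x) <= h].
  pose g (f : {ffun 'I_(size s) -> bool}) : option 'I_(size s) := [pick k | f k].
  rewrite (_ : (fun x => _) = g \o S); last first.
    by apply/funext => x /=; apply: eq_pick => j; rewrite /= ffunE.
  apply: measurable_preimage_finite_comp => f.
  apply: measurable_preimage_ffun => j b.
  have mle : measurable_fun setT (fun x : 'rV[R]_d => enorm (y j - x)).
    by apply: continuous_measurable_mx; exact: enorm_dist_continuous.
  rewrite -[X in measurable X]setTI.
  by apply: measurable_fun_ler => //; exact: measurable_cst.
- by move=> x k; case: pickP => // j hj [<-].
- move=> x; case: pickP => // hx _; rewrite leNgt; apply/negP => xr.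
  have [c /= cD cx] := cov x (ltW xr).
  have cs : c \in s by [].
  have ix : (index c s < size s)%N by rewrite index_mem.
  have := hx (Ordinal ix); rewrite /y/= nth_index// => /negbT.
  by rewrite (ltW cx).
Qed.

Section cost_of_plan.
Context {R : realType} {d N n : nat}.
Variables (p h r : R) (y : 'I_n -> 'rV[R]_d) (Q : 'rV[R]_d -> option 'I_n).
Hypotheses (p1 : 1 < p) (h0 : 0 < h) (r0 : 0 <= r) (yr : forall k, enorm (y k) <= r).
Hypothesis mQ : forall k, measurable (Q @^-1` [set k]).
Hypothesis Qh : forall x k, Q x = Some k -> enorm (y k - x) <= h.
Hypothesis Qr : forall x, Q x = None -> r <= enorm x.

(** The 3 comes from [|x - z| <= |x| + 2 r <= 3 |x|], for [z] in the ball of radius [2 r] and [x] in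
    the cell at infinity, where [r <= |x|]. *)
Definition tail_cost (x : 'rV[R]_d) : R := if Q x is None then (3 * enorm x) `^ p else 0.

Lemma infconv_cost_le (x : 'M[R]_(N, d)) z :
  infconv_cost p x <= \sum_i enorm (row i x - z) `^ p.
Proof.
apply: ge_inf; last by exists z.
by exists 0 => _ [u _ <-]; apply: sumr_ge0 => i _; exact: powR_ge0.
Qed.

Lemma infconv_cost_ge0 (x : 'M[R]_(N, d)) : 0 <= infconv_cost p x.
Proof.
apply: lb_le_inf; first by exists (\sum_i enorm (row i x - 0) `^ p), 0.
by move=> _ [u _ <-]; apply: sumr_ge0 => i _; exact: powR_ge0.
Qed.

(** If [|z| > 2 r], then [z] is farther than [r] from every centre, while 0 is within [r] of each:
    moving [z] to 0 does not increase the cost. *)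
Lemma partial_cost_near_min (k : {ffun 'I_N -> option 'I_n}) e : 0 < e ->
  exists2 z, enorm z <= 2 * r & partial_cost p y k z <= cell_cost p y k + e.
Proof.
move=> e0; have [_ [z _ <-] zk] := inf_adherent e0 (cell_cost_has_inf p y k).
have [zr|rz] := leP (enorm z) (2 * r); first by exists z => //; exact: ltW.
exists 0; first by rewrite enorm0 mulr_ge0.
apply: le_trans (ltW zk); rewrite /partial_cost; apply: ler_sum => i _; case: (k i) => [j|]; last by [].
have p1' := p1; have yj := yr j.
rewrite subr0 ge0_ler_powR ?nnegrE ?enorm_ge0//; first lra.
have := enorm_triangle (z - y j) (y j); rewrite subrK enormB; lra.
Qed.

(** Replacing [row i x] by its centre costs [s^(1 - p) h^p], near-minimality of [z] adds [h^p], and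
    rows in the cell at infinity are charged to [tail_cost]. *)
Lemma infconv_cost_cells s (x : 'M[R]_(N, d)) (k := [ffun i => Q (row i x)]) :
  0 < s -> s < 1 ->
  infconv_cost p x <= (1 - s) `^ (1 - p) * (cell_cost p y k + h `^ p) +
    N%:R * (s `^ (1 - p) * h `^ p) + \sum_i tail_cost (row i x).
Proof.
move=> s0 s1; have p1' := p1.
have [z zr zk] := partial_cost_near_min k (powR_gt0 p h0).
apply: le_trans (infconv_cost_le x z) _.
apply: (@le_trans _ _ (\sum_i ((1 - s) `^ (1 - p) *
   (if k i is Some j then enorm (y j - z) `^ p else 0) +
   (s `^ (1 - p) * h `^ p) + tail_cost (row i x)))).
  apply: ler_sum => i _; rewrite /tail_cost /k ffunE.
  have a0 : 0 <= s `^ (1 - p) * h `^ p by rewrite mulr_ge0 ?powR_ge0.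
  case Qx: (Q (row i x)) => [j|].
    rewrite addr0; apply: le_trans (powR_weighted_triangle p1 s0 s1 (enorm_ge0 _) (ltW h0)).
    rewrite ge0_ler_powR ?nnegrE ?enorm_ge0 ?addr_ge0 ?enorm_ge0 ?(ltW h0)//; first lra.
    rewrite (_ : row i x - z = (row i x - y j) + (y j - z)); last by rewrite addrA subrK.
    rewrite (le_trans (enorm_triangle _ _))// addrC lerD2l enormB; exact: Qh.
  rewrite mulr0 add0r ler_wpDl//.
  rewrite ge0_ler_powR ?nnegrE ?mulr_ge0 ?enorm_ge0//; first lra.
  rewrite (le_trans (enorm_triangle _ _))// enormN.
  have := Qr Qx; lra.
rewrite !big_split/= -mulr_sumr sumr_const card_ord -[X in _ + X + _ <= _]mulr_natl.
by rewrite !lerD2r ler_wpM2l ?powR_ge0.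
Qed.

(** The tail term splits over single rows, so it is integrated against the marginals and does not
    depend on the coupling. *)
Lemma cost_of_plan_le (mu : 'I_N -> probability 'rV[R]_d R) gamma
    (w : {ffun 'I_N -> option 'I_n} -> R) s : couplings mu gamma ->
  (forall k : {ffun 'I_N -> option 'I_n}, gamma [set x | forall i, Q (row i x) = k i] = (w k)%:E) ->
  \sum_k w k = 1 -> 0 < s -> s < 1 ->
  (\int[gamma]_x (infconv_cost p x)%:E <=
   ((1 - s) `^ (1 - p) * (\sum_k w k * cell_cost p y k + h `^ p) +
    N%:R * (s `^ (1 - p) * h `^ p))%:E +
    \sum_i \int[mu i]_x (tail_cost x)%:E)%E.
Proof.
move=> cg gw w1 s0 s1.
pose S (x : 'M[R]_(N, d)) : {ffun 'I_N -> option 'I_n} := [ffun i => Q (row i x)].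
have mS k : measurable (S @^-1` [set k]).
  apply: measurable_preimage_ffun => i j.
  by have := measurable_row i measurableT (mQ j); rewrite setTI.
pose F (k : {ffun 'I_N -> option 'I_n}) :=
  (1 - s) `^ (1 - p) * (cell_cost p y k + h `^ p) + N%:R * (s `^ (1 - p) * h `^ p).
have F0 k : 0 <= F k.
  by rewrite addr_ge0// ?mulr_ge0 ?powR_ge0// addr_ge0 ?powR_ge0// cell_cost_ge0.
have t0 x : 0 <= tail_cost x by rewrite /tail_cost; case: (Q x) => // *; rewrite powR_ge0.
have mtail : measurable_fun setT tail_cost.
  rewrite (_ : tail_cost = (fun x => (3 * enorm x) `^ p *
      (if Q x is None then 1 else 0))); last first.
    by apply/funext => x; rewrite /tail_cost; case: (Q x) => *; rewrite (mulr0, mulr1).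
  apply: measurable_funM; last exact: (measurable_fun_finite (fun k : option 'I_n => if k is None then 1 else 0)).
  apply: (measurableT_comp (measurable_powR p)); apply: measurable_funM => //.
  by apply: measurable_enorm; exact: measurable_id.
have mtaili i : measurable_fun setT (fun x : 'M[R]_(N, d) => tail_cost (row i x)).
  by apply: measurableT_comp => //; exact: measurable_row.
have mF : measurable_fun setT (fun x => F (S x)) by exact: measurable_fun_finite.
apply: (@le_trans _ _ (\int[gamma]_x ((F (S x))%:E + \sum_i (tail_cost (row i x))%:E))%E).
  apply: ge0_le_integralW => x _; first by rewrite lee_fin infconv_cost_ge0.
  by rewrite sumEFin -EFinD lee_fin; exact: infconv_cost_cells.
rewrite ge0_integralD//=; last 4 first.
- by move=> x _; rewrite lee_fin.
- exact/measurable_EFinP.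
- by move=> x _; apply: sume_ge0 => i _; rewrite lee_fin.
- by apply: emeasurable_sum => i; exact/measurable_EFinP.
apply: leeD.
  rewrite (integral_finite gamma F mS) lee_fin /F.
  have gS k : fine (gamma (S @^-1` [set k])) = w k.
    rewrite -[RHS]/(fine (w k)%:E) -gw; congr (fine (gamma _)).
    apply/seteqP; split => x /=; first by move=> <- i; rewrite /S ffunE.
    by move=> h'; apply/ffunP => i; rewrite ffunE.
  set a := (1 - s) `^ (1 - p); set b := N%:R * _.
  rewrite (eq_bigr (fun k => a * (w k * cell_cost p y k) + (a * h `^ p + b) * w k)).
    by rewrite big_split/= -!mulr_sumr w1 mulr1 mulrDr addrA.
  by move=> k _; rewrite [X in _ * X](gS k); ring.
rewrite ge0_integral_sum//; last 2 first.
- by move=> i; exact/measurable_EFinP.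
- by move=> i x _; rewrite lee_fin.
apply: lee_sum => i _.
rewrite (coupling_ge0_integral (g := fun x => (tail_cost x)%:E) i cg)//.
exact/measurable_EFinP.
Qed.

End cost_of_plan.

Section tails.
Context {R : realType} {d : nat}.

(** Dominated convergence. The threshold is uniform in [E] because the radius is fixed before the
    cells, and with them the set sent to infinity, are built. *)
Lemma tail_integral_small (mu : probability 'rV[R]_d R) (p e : R) : Pp p mu -> 0 < e ->
  exists r0 : R, forall (r : R) (E : 'rV[R]_d -> bool), r0 <= r ->
    (forall x, E x -> r <= enorm x) ->
    (\int[mu]_x (if E x then (3 * enorm x) `^ p else 0)%:E <= e%:E)%E.
Proof.
move=> mup e0.
pose f (x : 'rV[R]_d) := ((3 * enorm x) `^ p)%:E.
have mf : measurable_fun setT (fun x : 'rV[R]_d => (3 * enorm x) `^ p).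
  apply: (measurableT_comp (measurable_powR p)); apply: measurable_funM => //.
  by apply: measurable_enorm; exact: measurable_id.
have mEf : measurable_fun setT f by exact/measurable_EFinP.
have f0 x : (0 <= f x)%E by rewrite lee_fin powR_ge0.
have fint : mu.-integrable setT f.
  apply/integrableP; split => //; under eq_integral do rewrite gee0_abs//.
  rewrite /f; under eq_integral do rewrite powRM ?enorm_ge0// EFinM.
  rewrite ge0_integralZl//; last 2 first.
  - apply/measurable_EFinP; apply: (measurableT_comp (measurable_powR p)).
    by apply: measurable_enorm; exact: measurable_id.
  - by move=> x _; rewrite lee_fin powR_ge0.
  by rewrite lte_mul_pinfty// ?lee_fin ?powR_ge0.
pose g (n : nat) (x : 'rV[R]_d) := (f x * (\1_[set x | n%:R <= enorm x] x)%:E)%E.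
have mset n : measurable [set x : 'rV[R]_d | n%:R <= enorm x].
  rewrite (_ : [set _ | _] = setT `&` (fun x : 'rV[R]_d => n%:R <= enorm x) @^-1` [set true]).
    apply: measurable_fun_ler => //; apply: measurable_enorm; exact: measurable_id.
  by rewrite setTI; apply/seteqP; split => x.
have mg n : measurable_fun setT (g n).
  by apply: emeasurable_funM => //; apply/measurable_EFinP; exact: measurable_indic.
have gf n x : (`|g n x| <= f x)%E.
  rewrite /g indicE; case: (x \in _); last by rewrite mule0 abse0.
  by rewrite mule1 gee0_abs.
have glim x : g ^~ x @ \oo --> 0%E.
  apply: cvg_near_cst; near=> n; rewrite /g indicE memNset ?mule0//=.
  apply/negP; rewrite -ltNge; near: n; exact: nbhs_infty_gtr.
have [_ _ +] := dominated_convergence measurableT mg (measurable_cst 0%E)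
  (aeW _ (fun x _ => glim x)) fint (aeW _ (fun x n _ => gf n x)).
rewrite integral0 => /fine_cvgP[_ /cvgrPdist_lt /(_ _ e0)[n _ /(_ n (leqnn n))]] /=.
rewrite sub0r normrN => gn; exists n%:R => r E nr Er.
apply: (@le_trans _ _ (\int[mu]_x g n x)%E).
  apply: ge0_le_integralW => x _; first by case: ifP => // _; rewrite lee_fin powR_ge0.
  case: ifPn => [Ex|_]; last by rewrite mule_ge0// lee_fin.
  by rewrite /g indicE mem_set ?mule1//= (le_trans nr)// Er.
have gfin : (\int[mu]_x g n x)%E \is a fin_num.
  apply: integrable_fin_num => //; apply: le_integrable fint => // x _.
  by rewrite (gee0_abs (f0 x)).
by rewrite -(fineK gfin) lee_fin (le_trans (ler_norm _))// ltW.
Unshelve. all: by end_near. Qed.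

End tails.

Lemma mmot_value_le_action (R : realType) (d N : nat) (p : R)
    (mu : 'I_N -> probability 'rV[R]_d R) rv :
  (0 < N)%N -> 1 < p -> (forall i, Pp p (mu i)) -> admissible p mu rv ->
  (mmot_value (infconv_cost p) mu <= action p rv.1 rv.2)%E.
Proof.
move=> N0 p1 mup [_ [nu _ wce]].
have A0 : (0 <= action p rv.1 rv.2)%E.
  apply: integral_ge0 => t _; apply: sume_ge0 => i _.
  by apply: integral_ge0 => x _; rewrite lee_fin powR_ge0.
have [->|Aoo] := eqVneq (action p rv.1 rv.2) +oo%E; first by rewrite leey.
have Afin : action p rv.1 rv.2 \is a fin_num by rewrite ge0_fin_numE// ltey.
pose A := fine (action p rv.1 rv.2).
have AE : action p rv.1 rv.2 = A%:E by rewrite fineK.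
have {}A0 : 0 <= A by rewrite -lee_fin -AE.
have key (s e : R) : 0 < s -> s < 1 -> 0 < e ->
    (mmot_value (infconv_cost p) mu <= (((1 - s) `^ (1 - p)) ^+ 2 * A + e)%:E)%E.
  move=> s0 s1 e0.
  have s1' : 0 < 1 - s by lra.
  (* The delay of the apex, chosen so that [1 + q = 1 / (1 - s)]: the loss from the delay and the
     loss from the weighted triangle inequality are then the same factor [u]. *)
  pose q := s / (1 - s).
  have q0 : 0 < q by rewrite divr_gt0.
  have q1 : 1 + q = (1 - s)^-1 by rewrite /q; field; rewrite gt_eqF.
  pose u := (1 - s) `^ (1 - p).
  have u0 : 0 < u by rewrite powR_gt0.
  have qu : (1 + q) `^ (1 - p) = u^-1.
    by rewrite q1 -powR_inv1 ?(ltW s1')// -powRrM mulrC powRrM powR_inv1 ?powR_ge0.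
  have e2 : 0 < e / 2 / N%:R by rewrite !divr_gt0// ltr0n.
  have /choice[rr rrP] := fun i => tail_integral_small (mup i) e2.
  pose r := \sum_i `|rr i|.
  have r0 : 0 <= r by exact: sumr_ge0.
  have rri i : rr i <= r.
    by rewrite (le_trans (ler_norm _))// /r (bigD1 i)//= lerDl; exact: sumr_ge0.
  (* The total coefficient of [h^p]: the dual error carried through both factors [u], the
     near-minimality of [z], and the distance to the centres. [h] is then chosen to make this part
     at most [e / 2]; the tails take the other half. *)
  pose B := u ^+ 2 * (N%:R * (q `^ (1 - p) * 2 `^ (p / 2))) + u + N%:R * s `^ (1 - p).
  have B0 : 0 <= B by rewrite !addr_ge0// ?mulr_ge0 ?sqr_ge0 ?powR_ge0// ltW.
  pose h := (e / 2 / (B + 1)) `^ p^-1.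
  have B1 : 0 < B + 1 by lra.
  have h0 : 0 < h by rewrite powR_gt0// !divr_gt0.
  have hp : h `^ p = e / 2 / (B + 1).
    rewrite -powRrM mulVf ?powRr1//; last by rewrite gt_eqF//; lra.
    by rewrite !divr_ge0// ltW.
  have [n [y [Q [yr mQ Qh Qr]]]] := @enorm_cells R d r h h0.
  (* Taking [eta = h^2] makes the dual error a multiple of [h^p]. *)
  have dual := @dual_value_le_action R d N n p h y Q p1 mQ Qh mu nu rv.1 rv.2 wce
    q (h ^+ 2) A.
  have h2p : (h ^+ 2 + h ^+ 2) `^ (p / 2) = 2 `^ (p / 2) * h `^ p.
    have -> : h ^+ 2 + h ^+ 2 = 2 * h ^+ 2 by ring.
    by rewrite powRM ?sqr_ge0// powR_sqr// ltW.
  have [||w [w0 wm wV]] := @transport_duality R N (option 'I_n)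
    (fun i k => fine (mu i (Q @^-1` [set k])))
    (fun k => (1 + q) `^ (1 - p) * cell_cost p y k)
    (A + N%:R * (q `^ (1 - p) * (h ^+ 2 + h ^+ 2) `^ (p / 2))).
  - by move=> k; rewrite mulr_ge0 ?powR_ge0 ?cell_cost_ge0.
  - by move=> a ha; apply: dual => //; rewrite exprn_gt0.
  have [gamma cg gw] := coupling_of_plan N0 mQ w0 wm.
  have w1 : \sum_k w k = 1.
    apply: EFin_inj; rewrite -sumEFin -(probability_setT gamma).
    pose S (x : 'M[R]_(N, d)) : {ffun 'I_N -> option 'I_n} := [ffun i => Q (row i x)].
    have mS k : measurable (S @^-1` [set k]).
      apply: measurable_preimage_ffun => i j.
      by have := measurable_row i measurableT (mQ j); rewrite setTI.
    rewrite (measure_finite_partition gamma mS measurableT).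
    apply: eq_bigr => k _; rewrite -gw setTI; congr (gamma _).
    apply/seteqP; split => x /=; last by move=> <- i; rewrite /S ffunE.
    by move=> h'; apply/ffunP => i; rewrite ffunE.
  apply: (@le_trans _ _ (\int[gamma]_x (infconv_cost p x)%:E)%E).
    by apply: ereal_inf_lbound; exists gamma.
  apply: le_trans (cost_of_plan_le p1 h0 r0 yr mQ Qh Qr cg gw w1 s0 s1) _.
  rewrite -/u.
  have tail : (\sum_i \int[mu i]_x (tail_cost p Q x)%:E <= (e / 2)%:E)%E.
    apply: (@le_trans _ _ (\sum_(i < N) (e / 2 / N%:R)%:E)%E).
      apply: lee_sum => i _.
      apply: le_trans (rrP i r (fun x => Q x == None) (rri i) _).
        apply: ge0_le_integralW => x _; rewrite /tail_cost.
          by case: (Q x) => *; rewrite lee_fin// powR_ge0.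
        by case: (Q x).
      by move=> x /eqP; exact: Qr.
    rewrite sumEFin sumr_const card_ord lee_fin -[leLHS]mulr_natl mulrC divfK//.
    by rewrite gt_eqF// ltr0n.
  apply: le_trans (leeD (lexx _) tail) _; rewrite -EFinD lee_fin.
  have wc : \sum_k w k * cell_cost p y k <= u * (A + N%:R * (q `^ (1 - p) * (2 `^ (p / 2) * h `^ p))).
    rewrite -ler_pdivrMl//; rewrite h2p qu in wV; apply: le_trans wV.
    rewrite mulr_sumr; apply: ler_sum => k _; rewrite mulrCA//.
  have hB : B * h `^ p <= e / 2.
    rewrite hp mulrA ler_pdivrMr// mulrC ler_wpM2l ?divr_ge0 ?(ltW e0)//.
    by rewrite lerDl.
  have := ler_wpM2l (ltW u0) wc.
  move: hB; rewrite /B; set a1 := q `^ _; set a2 := 2 `^ _; set a3 := s `^ _; set a4 := h `^ _.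
  clear; nra.
rewrite AE.
have C0 : (0 <= mmot_value (infconv_cost p) mu)%E.
  apply: le_ereal_inf_tmp => _ [gamma _ <-]; apply: integral_ge0 => x _.
  by rewrite lee_fin infconv_cost_ge0.
have Cfin : mmot_value (infconv_cost p) mu \is a fin_num.
  rewrite ge0_fin_numE//; apply: le_lt_trans (key (1 / 2) 1 _ _ _) (ltry _); lra.
rewrite -(fineK Cfin) lee_fin; set C := fine _.
have keyC s : 0 < s -> s < 1 -> C <= ((1 - s) `^ (1 - p)) ^+ 2 * A.
  move=> s0 s1; apply/ler_addgt0Pr => e e0.
  by rewrite -lee_fin /C fineK//; exact: key.
rewrite leNgt; apply/negP => AC.
have C1 : 0 < C by exact: le_lt_trans AC.
(* With [s = 1 - t] for the [t] below, the factor in [keyC] becomes [b^-1]; then [C <= A / b] means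
   [(A + C) / 2 <= A], against [A < C]. *)
pose b := (A + C) / (2 * C).
have b0 : 0 < b by rewrite divr_gt0//; lra.
have b1 : b < 1 by rewrite ltr_pdivrMr//; lra.
pose t := b `^ (2 * (p - 1))^-1.
have t0 : 0 < t by rewrite powR_gt0.
have p2 : 0 < (2 * (p - 1))^-1 by rewrite invr_gt0; lra.
have t1 : t < 1.
  by have := gt0_ltr_powR p2 (ltW b0) ler01 b1; rewrite powR1.
have := keyC (1 - t); rewrite subKr.
have -> : (t `^ (1 - p)) ^+ 2 = b^-1.
  rewrite -powR_mulrn ?powR_ge0// -!powRrM -(powR_inv1 (ltW b0)).
  congr (_ `^ _); have p0 : p - 1 != 0 by rewrite gt_eqF//; lra.
  by field.
rewrite subr_gt0 t1 ltrBlDr ltrDl t0 => /(_ isT isT).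
rewrite mulrC ler_pdivlMr// /b mulrA ler_pdivrMr; last lra.
nra.
Qed.

(** * Conditional expectations and Jensen's inequality *)

Section conditional_expectation.
Context {R : realType} {d d' : measure_display} {W : measurableType d} {T : measurableType d'}.
Variables (P : probability W R) (Phi : W -> T).
Hypothesis mPhi : measurable_fun setT Phi.

Import HBNNSimple.

Lemma integrable_bounded_mul (u h : W -> R) (M : R) : measurable_fun setT u ->
  (forall x, `|u x| <= M) -> P.-integrable setT (EFin \o h) ->
  P.-integrable setT (fun x => (u x * h x)%:E).
Proof.
move=> mu uM ih.
have mh : measurable_fun setT h by apply/measurable_EFinP; exact: measurable_int ih.
apply: (@le_integrable _ _ _ P setT measurableT _ (fun x => (M * h x)%:E)).
- by apply/measurable_EFinP; exact: measurable_funM.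
- move=> x _ /=; rewrite lee_fin !normrM ler_wpM2r//.
  by rewrite (le_trans (uM x))// ler_norm.
- rewrite (_ : (fun _ => _) = (fun x => M%:E * (EFin \o h) x)%E).
    exact: integrableZl.
  by apply/funext => x /=; rewrite EFinM.
Qed.

(** From indicators to simple functions by linearity, to bounded nonnegative functions by dominated
    convergence, to bounded functions by adding a constant. *)
Lemma bounded_orthogonal (h : W -> R) : P.-integrable setT (EFin \o h) ->
  (forall A, measurable A -> (\int[P]_(x in Phi @^-1` A) (h x)%:E = 0)%E) ->
  forall (u : T -> R) (M : R), measurable_fun setT u -> (forall y, `|u y| <= M) ->
  (\int[P]_x (u (Phi x) * h x)%:E = 0)%E.
Proof.
move=> ih hA.
have mPA (A : set T) : measurable A -> measurable (Phi @^-1` A).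
  by move=> mA; rewrite -[X in measurable X]setTI; exact: mPhi.
have indicP A : measurable A -> (\int[P]_x (\1_A (Phi x) * h x)%:E = 0)%E.
  move=> mA; rewrite -[RHS](hA _ mA) integral_mkcond [RHS]integral_mkcond.
  apply: eq_integral => x _; rewrite patch_setT/= /patch indicE.
  rewrite (_ : (x \in Phi @^-1` A) = (Phi x \in A)); last first.
    by apply/idP/idP; rewrite !inE.
  by case: (_ \in _); rewrite (mul1r, mul0r).
have ind1 A : measurable A -> P.-integrable setT (fun x => (\1_A (Phi x) * h x)%:E).
  move=> mA; apply: (@integrable_bounded_mul _ _ 1) => //.
    apply: measurableT_comp => //; exact: measurable_indic.
  by move=> x; rewrite indicE; case: (_ \in _); rewrite ?normr1 ?normr0.
have sfunP (s : {nnsfun T >-> R}) : (\int[P]_x (s (Phi x) * h x)%:E = 0)%E.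
  transitivity (\int[P]_x (\sum_(r <- finmap.enum_fset (fset_set (range s)))
      (r%:E * (\1_(s @^-1` [set r]) (Phi x) * h x)%:E)))%E.
    apply: eq_integral => x _.
    rewrite fimfunE fsbig_finite//= mulr_suml -sumEFin; apply: eq_bigr => r _.
    by rewrite -EFinM mulrA.
  rewrite integral_sum//.
    rewrite big1// => r _; rewrite integralZl//; last exact: ind1.
    by rewrite indicP ?mule0.
  by move=> r; apply: integrableZl => //; exact: ind1.
have pos (u : T -> R) (M : R) : measurable_fun setT u -> (forall y, 0 <= u y <= M) ->
    (\int[P]_x (u (Phi x) * h x)%:E = 0)%E.
  move=> mu uM.
  have mEu : measurable_fun setT (EFin \o u) by exact/measurable_EFinP.
  pose s := nnsfun_approx measurableT mEu.
  have scvg y : (s n y)%:E @[n --> \oo] --> (u y)%:E.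
    by apply: cvg_nnsfun_approx => // z _; rewrite lee_fin; case/andP: (uM z).
  have su n y : s n y <= u y.
    have nd : nondecreasing_seq (fun n => (s n y)%:E).
      by move=> i j ij; rewrite lee_fin; exact/lefP/nd_nnsfun_approx.
    have /(cvg_unique (@ereal_hausdorff R)) := ereal_nondecreasing_cvgn nd.
    move=> /(_ _ (scvg y)) E; rewrite -lee_fin -E.
    by apply: ereal_sup_ubound; exists n.
  have mh : measurable_fun setT h by apply/measurable_EFinP; exact: measurable_int ih.
  have [|||||_ _ ] := @dominated_convergence _ _ _ P setT measurableT
     (fun n x => (s n (Phi x) * h x)%:E) (fun x => (u (Phi x) * h x)%:E)
     (fun x => (`|M * h x|)%:E).
  - by move=> n; apply/measurable_EFinP; apply: measurable_funM => //; exact: measurableT_comp.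
  - by apply/measurable_EFinP; apply: measurable_funM => //; exact: measurableT_comp.
  - apply: aeW => x _; under eq_fun do rewrite EFinM.
    by rewrite EFinM; apply: cvgeZr.
  - rewrite (_ : (fun x => _) = (fun x => `|(M%:E * (EFin \o h) x)|%E)).
      by apply: integrable_abse; exact: integrableZl.
    by apply/funext => x /=.
  - apply: aeW => x n _ /=; rewrite lee_fin !normrM ler_wpM2r//.
    rewrite ger0_norm// (le_trans (su n _))//; case/andP: (uM (Phi x)) => _ uM'.
    by rewrite (le_trans uM')// ler_norm.
  rewrite (_ : [sequence _]_n = cst 0%E); last by apply/funext => n /=; exact: sfunP.
  by move=> /(@cvg_unique _ (@ereal_hausdorff R) _ _ _ _ (cvg_cst _)) <-.
move=> u M mu uM.
have M0 : 0 <= M by rewrite (le_trans _ (uM point)).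
transitivity (\int[P]_x (((u (Phi x) + M) * h x)%:E - (M * h x)%:E))%E.
  by apply: eq_integral => x _; rewrite -EFinB; congr (_%:E); ring.
have mPhi' := mPhi.
rewrite integralB//; last 2 first.
- apply: (@integrable_bounded_mul (fun x => u (Phi x) + M) _ (2 * M)) => //.
    apply: measurable_funD => //; exact: measurableT_comp.
  move=> x; have := uM (Phi x); rewrite !ler_norml => /andP[? ?]; apply/andP; split; lra.
- apply: (@integrable_bounded_mul (fun x => M) _ `|M|) => //.
rewrite (pos (fun y => u y + M) (2 * M)).
- by rewrite (pos (fun=> M) M) ?sube0// => y; rewrite M0 lexx.
- exact: measurable_funD.
- move=> y; have := uM y; rewrite ler_norml => /andP[? ?]; apply/andP; split; lra.
Qed.

(** [g] is the Radon-Nikodym derivative of the image under [Phi] of the signed measure [f P] with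
    respect to the law of [Phi]. It is thus directly a function on [T], as a velocity field must be
    a function of time and position. *)
Lemma conditional_expectation_exists (f : W -> R) : P.-integrable setT (EFin \o f) ->
  exists g : T -> R, [/\ measurable_fun setT g,
    P.-integrable setT (EFin \o (g \o Phi)) &
    forall (u : T -> R) (M : R), measurable_fun setT u -> (forall y, `|u y| <= M) ->
      (\int[P]_x (u (Phi x) * g (Phi x))%:E = \int[P]_x (u (Phi x) * f x)%:E)%E].
Proof.
move=> fint.
pose nu0 : {charge set W -> \bar R} := induced_charge fint.
pose nu' : {charge set T -> \bar R} := pushforward nu0 Phi.
pose nu := nu' mPhi.
pose m : probability T R := law P mPhi.
have mPA (A : set T) : measurable A -> measurable (Phi @^-1` A).
  by move=> mA; rewrite -[X in measurable X]setTI; exact: mPhi.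
have num : nu `<< m.
  apply/null_content_dominatesP => A mA mA0.
  rewrite /nu /nu' /= /pushforward /nu0 /= /induced_charge.
  apply: null_set_integral; [exact: mPA|exact: measurable_funS (measurable_int _ fint)|exact: mA0].
pose g0 := Radon_Nikodym nu m.
have g0fin y : g0 y \is a fin_num by exact: Radon_Nikodym_fin_num.
have g0int : m.-integrable setT g0 by exact: Radon_Nikodym_integrable.
pose g y := fine (g0 y).
have gE y : (g y)%:E = g0 y by rewrite fineK.
have mg : measurable_fun setT g.
  by apply/measurable_EFinP; rewrite (_ : _ \o _ = g0); [exact: measurable_int g0int|exact/funext].
have gPint : P.-integrable setT (EFin \o (g \o Phi)).
  apply/integrableP; split.
    by apply/measurable_EFinP; exact: measurableT_comp.
  have /integrableP[_] := g0int.
  rewrite ge0_integral_law//; last exact: measurableT_comp (measurable_int _ g0int).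
  by rewrite (_ : (EFin \o _) = g0 \o Phi)//; apply/funext => x /=; rewrite gE.
exists g; split => // u M mu uM.
have mPhi' := mPhi.
pose h x := g (Phi x) - f x.
have hint : P.-integrable setT (EFin \o h).
  rewrite (_ : EFin \o h = ((EFin \o (g \o Phi)) \- (EFin \o f)))%E.
    exact: integrableB.
  by apply/funext => x.
have h0 (A : set T) : measurable A -> (\int[P]_(x in Phi @^-1` A) (h x)%:E = 0)%E.
  move=> mA; under eq_integral do rewrite /h EFinB.
  have iS (k : W -> R) : P.-integrable setT (EFin \o k) -> P.-integrable (Phi @^-1` A) (EFin \o k).
    by move=> ik; apply: (integrableS measurableT) => //; exact: mPA.
  rewrite integralB//; [|exact: mPA|exact: (iS (g \o Phi))|exact: (iS f)].
  have -> : (\int[P]_(x in Phi @^-1` A) (f x)%:E = nu A)%E by [].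
  rewrite (Radon_Nikodym_integral num mA).
  have mg0 : measurable_fun setT g0 by exact: measurable_int g0int.
  have E : (\int[m]_(x in A) g0 x = \int[P]_(x in Phi @^-1` A) (g (Phi x))%:E)%E.
    apply: etrans (integral_pushforward mPhi mg0 _ mA) _.
      apply: eq_integrable (iS (g \o Phi) gPint); first exact: mPA.
      by move=> x _ /=; rewrite gE.
    by apply: eq_integral => x _ /=; rewrite gE.
  rewrite -/g0 E subee//; apply: integrable_fin_num; [exact: mPA|exact: (iS (g \o Phi))].
have uh := bounded_orthogonal hint h0 mu uM.
have ui (k : W -> R) : P.-integrable setT (EFin \o k) -> P.-integrable setT (fun x => (u (Phi x) * k x)%:E).
  by move=> ik; apply: (integrable_bounded_mul (M := M)) => //; exact: measurableT_comp.
have fin (k : W -> R) : P.-integrable setT (EFin \o k) ->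
    (\int[P]_x (u (Phi x) * k x)%:E)%E \is a fin_num.
  by move=> ik; apply: integrable_fin_num => //; exact: ui.
have := uh; rewrite (_ : (\int[P]_x _ = \int[P]_x ((u (Phi x) * g (Phi x))%:E - (u (Phi x) * f x)%:E))%E).
  rewrite integralB//; [|exact: (ui (g \o Phi))|exact: ui].
  have f1 := fin (g \o Phi) gPint; have f2 := fin f fint.
  by move=> /eqP; rewrite sube_eq ?add0e// => /eqP.
by apply: eq_integral => x _; rewrite -EFinB /h mulrBr.
Qed.

End conditional_expectation.

Section vector_conditional_expectation.
Context {R : realType} {dW dT : measure_display} {W : measurableType dW} {T : measurableType dT}.
Context {d : nat}.
Variables (P : probability W R) (Phi : W -> T).
Hypothesis mPhi : measurable_fun setT Phi.

Lemma measurable_coord {dD : measure_display} (X : measurableType dD) m n (D : set X)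
    (f : X -> 'M[R]_(m, n)) i j :
  measurable_fun D f -> measurable_fun D (fun x => f x i j).
Proof.
move=> mf; apply: (@measurable_comp _ _ _ _ _ _ setT (fun x : 'M[R]_(m, n) => x i j) D f) => //.
exact: measurable_mx_coord.
Qed.

Lemma measurable_powR_enorm {dD : measure_display} (X : measurableType dD) (D : set X)
    (f : X -> 'rV[R]_d) (p : R) :
  measurable_fun D f -> measurable_fun D (fun x => enorm (f x) `^ p).
Proof.
move=> mf; apply: (@measurable_comp _ _ _ _ _ _ setT (fun a : R => a `^ p) D (fun x => enorm (f x))) => //.
exact: measurable_enorm.
Qed.

Lemma ler_powR_add1 (a p : R) : 0 <= a -> 1 <= p -> a <= 1 + a `^ p.
Proof.
move=> a0 p1; have [a1|a1] := leP a 1; first by rewrite (le_trans a1)// lerDl powR_ge0.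
by rewrite -[leLHS]powRr1// (le_trans (y := a `^ p)) ?lerDr// ler_powR// ltW.
Qed.

Lemma integrable_powR_enorm (f : W -> 'rV[R]_d) (p : R) : 1 <= p ->
  measurable_fun setT f -> (\int[P]_x (enorm (f x) `^ p)%:E < +oo)%E ->
  P.-integrable setT (fun x => (enorm (f x) `^ p)%:E).
Proof.
move=> p1 mf fp; apply/integrableP; split.
  by apply/measurable_EFinP; exact: measurable_powR_enorm.
by under eq_integral do rewrite /= ger0_norm ?powR_ge0//.
Qed.

Lemma integrable_enorm (f : W -> 'rV[R]_d) (p : R) : 1 <= p ->
  measurable_fun setT f -> (\int[P]_x (enorm (f x) `^ p)%:E < +oo)%E ->
  P.-integrable setT (fun x => (enorm (f x))%:E).
Proof.
move=> p1 mf fp.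
apply: (@le_integrable _ _ _ P setT measurableT _ (fun x => (1%:E + (enorm (f x) `^ p)%:E)%E)).
- by apply/measurable_EFinP; exact: measurable_enorm.
- move=> x _; rewrite -EFinD /= lee_fin ger0_norm ?enorm_ge0// ger0_norm ?addr_ge0 ?powR_ge0//.
  by rewrite ler_powR_add1 ?enorm_ge0.
- apply: integrableD => //; last exact: integrable_powR_enorm.
  by apply: finite_measure_integrable_cst.
Qed.

Lemma integrable_coord (f : W -> 'rV[R]_d) j : measurable_fun setT f ->
  P.-integrable setT (fun x => (enorm (f x))%:E) -> P.-integrable setT (fun x => (f x ord0 j)%:E).
Proof.
move=> mf; apply: le_integrable => //.
  apply/measurable_EFinP; exact: measurable_coord.
by move=> x _ /=; rewrite lee_fin (ger0_norm (enorm_ge0 _)) coord_le_enorm.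
Qed.

Lemma integrable_dotp (u f : W -> 'rV[R]_d) (M : R) : measurable_fun setT u ->
  (forall x j, `|u x ord0 j| <= M) -> (forall j, P.-integrable setT (fun x => (f x ord0 j)%:E)) ->
  P.-integrable setT (fun x => (dotp (u x) (f x))%:E).
Proof.
move=> mu uM fi.
rewrite (_ : (fun x => _) = (fun x => \sum_(j < d) (u x ord0 j * f x ord0 j)%:E)%E); last first.
  by apply/funext => x; rewrite sumEFin.
apply: integrable_sum => // j _.
apply: (integrable_bounded_mul (M := M) (h := fun x => f x ord0 j)) => //.
  exact: measurable_coord.
exact: fi.
Qed.

(** Jensen's inequality by duality: [f] and [g] have equal integrals against a truncation [psi n] of
    [|g|^(p-2) g], and [young_powR] bounds [p psi . f] by [(p-1) psi . g + |f|^p]. Finiteness allows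
    the subtraction, and monotone convergence removes the truncation. *)
Lemma conditional_field_exists (f : W -> 'rV[R]_d) (p : R) : 1 < p ->
  measurable_fun setT f -> (\int[P]_x (enorm (f x) `^ p)%:E < +oo)%E ->
  exists g : T -> 'rV[R]_d, [/\ measurable_fun setT g,
    (\int[P]_x (enorm (g (Phi x)) `^ p)%:E <= \int[P]_x (enorm (f x) `^ p)%:E)%E &
    forall (u : T -> 'rV[R]_d) (M : R), measurable_fun setT u ->
      (forall y j, `|u y ord0 j| <= M) ->
      (\int[P]_x (dotp (u (Phi x)) (g (Phi x)))%:E = \int[P]_x (dotp (u (Phi x)) (f x))%:E)%E].
Proof.
move=> p1 mf fp; have p1' : 1 <= p by lra.
have mPhi' := mPhi.
have fi := integrable_enorm p1' mf fp.
have fij j := integrable_coord j mf fi.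
have /choice[g0 g0P] j := conditional_expectation_exists mPhi (fij j).
pose g y : 'rV[R]_d := \row_j g0 j y.
have mg : measurable_fun setT g.
  apply: measurable_fun_mx => // i j; under eq_fun do rewrite mxE.
  by case: (g0P j).
have gij j : P.-integrable setT (fun x => (g (Phi x) ord0 j)%:E).
  under [X in _.-integrable _ X]eq_fun do rewrite mxE.
  by case: (g0P j).
have swap (u : T -> 'rV[R]_d) (M : R) : measurable_fun setT u ->
      (forall y j, `|u y ord0 j| <= M) ->
      (\int[P]_x (dotp (u (Phi x)) (g (Phi x)))%:E = \int[P]_x (dotp (u (Phi x)) (f x))%:E)%E.
  move=> mu uM.
  have muj j : measurable_fun setT (fun y => u y ord0 j).
    exact: measurable_coord.
  under eq_integral do rewrite /dotp -sumEFin.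
  under [RHS]eq_integral do rewrite /dotp -sumEFin.
  rewrite !integral_sum//; first last.
  - move=> j; apply: (integrable_bounded_mul (M := M) (u := fun x => u (Phi x) ord0 j)
      (h := fun x => g (Phi x) ord0 j)) (gij j) => //.
    exact: (measurableT_comp (muj j)).
  - move=> j; apply: (integrable_bounded_mul (M := M) (u := fun x => u (Phi x) ord0 j)
      (h := fun x => f x ord0 j)) (fij j) => //.
    exact: (measurableT_comp (muj j)).
  apply: eq_bigr => j _; case: (g0P j) => _ _ /(_ (fun y => u y ord0 j) M) <- //.
  by apply: eq_integral => x _; rewrite mxE.
exists g; split; [exact: mg| |exact: swap].
clearbody g; clear g0P.
pose B n y := (enorm (g y) <= n%:R)%R.
have mB n : measurable [set y | B n y].
  rewrite (_ : [set y | _] = (fun y => enorm (g y)) @^-1` `]-oo, n%:R]).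
    rewrite -[X in measurable X]setTI; apply: (measurable_enorm mg) => //.
  by apply/seteqP; split=> y /=; rewrite in_itv.
(* Truncating to [|g| <= n] makes [psi n] a bounded field, to which [swap] applies. *)
pose psi n y : 'rV[R]_d := (\1_[set y | B n y] y * enorm (g y) `^ (p - 2)) *: g y.
have mpsi n : measurable_fun setT (psi n).
  apply: measurable_fun_mx => // i j; under eq_fun do rewrite mxE.
  apply: measurable_funM.
    apply: measurable_funM; first exact: measurable_indic.
    exact: measurable_powR_enorm.
  exact: measurable_coord.
(* The exponent [p - 2] may be negative, so the value at 0 is treated apart. *)
have pw a : 0 <= a -> a `^ (p - 2) * a = a `^ (p - 1) :> R.
  rewrite le_eqVlt => /predU1P[<-|a0]; first by rewrite mulr0 powR0//; lra.
  rewrite -[X in _ * X](powRr1 (ltW a0)) -powRD; last by apply/implyP => _; rewrite gt_eqF.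
  by congr (_ `^ _); lra.
have pw1 a : 0 <= a -> a `^ (p - 1) * a = a `^ p :> R.
  rewrite le_eqVlt => /predU1P[<-|a0]; first by rewrite mulr0 powR0//; lra.
  rewrite -[X in _ * X](powRr1 (ltW a0)) -powRD; last by apply/implyP => _; rewrite gt_eqF.
  by congr (_ `^ _); lra.
have indB n y : \1_[set y | B n y] y = (B n y)%:R :> R.
  by rewrite indicE (_ : (y \in _) = B n y)//; apply/idP/idP; rewrite inE.
have psiB n y j : `|psi n y ord0 j| <= n%:R `^ (p - 1).
  rewrite mxE !normrM indB; case: (boolP (B n y)) => [By|_]; rewrite ?normr0 ?mul0r ?powR_ge0//.
  rewrite normr1 mul1r (ger0_norm (powR_ge0 _ _)).
  rewrite (le_trans (y := enorm (g y) `^ (p - 2) * enorm (g y)))//.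
    by rewrite ler_wpM2l ?powR_ge0// coord_le_enorm.
  by rewrite pw ?enorm_ge0// ge0_ler_powR ?nnegrE ?enorm_ge0//; lra.
have psig n y : dotp (psi n y) (g y) = \1_[set y | B n y] y * enorm (g y) `^ p.
  rewrite dotpZl -sqr_enorm -mulrA; congr (_ * _).
  by rewrite expr2 mulrA pw ?enorm_ge0// pw1 ?enorm_ge0.
have young n x : p * dotp (psi n (Phi x)) (f x) <=
    (p - 1) * dotp (psi n (Phi x)) (g (Phi x)) + enorm (f x) `^ p.
  rewrite psig dotpZl indB; case: (B n _); last first.
    by rewrite !mul0r !mulr0 add0r powR_ge0.
  rewrite !mul1r; apply: le_trans (young_powR p1 (enorm_ge0 (g (Phi x))) (enorm_ge0 (f x))).
  rewrite -mulrA ler_wpM2l//; first by lra.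
  rewrite -pw ?enorm_ge0// -mulrA ler_wpM2l ?powR_ge0//; exact: dotp_le_enorm.
have psii n : P.-integrable setT (fun x => (dotp (psi n (Phi x)) (g (Phi x)))%:E).
  apply: (@integrable_dotp (psi n \o Phi) (g \o Phi) (n%:R `^ (p - 1))) gij; [exact: measurableT_comp|by move=> x j /=].
have psif n : P.-integrable setT (fun x => (dotp (psi n (Phi x)) (f x))%:E).
  apply: (@integrable_dotp (psi n \o Phi) f (n%:R `^ (p - 1))) fij; [exact: measurableT_comp|by move=> x j /=].
have bnd n : (\int[P]_x (dotp (psi n (Phi x)) (g (Phi x)))%:E <= \int[P]_x (enorm (f x) `^ p)%:E)%E.
  have Ifp := integrable_powR_enorm p1' mf fp.
  have : (\int[P]_x (p%:E * (dotp (psi n (Phi x)) (f x))%:E) <=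
    \int[P]_x ((p - 1)%:E * (dotp (psi n (Phi x)) (g (Phi x)))%:E + (enorm (f x) `^ p)%:E))%E.
    apply: le_integral => //.
    - exact: integrableZl.
    - by apply: integrableD => //; exact: integrableZl.
    - by move=> x _; rewrite -!EFinM -EFinD lee_fin young.
  rewrite integralZl// integralD//; last exact: integrableZl.
  rewrite integralZl// -(swap _ _ (mpsi n) (psiB n)).
  have /fineK <- := integrable_fin_num measurableT (psii n).
  have /fineK <- := integrable_fin_num measurableT Ifp.
  by rewrite -!EFinM -EFinD !lee_fin; lra.
have mpsig n : measurable_fun setT (fun x => (dotp (psi n (Phi x)) (g (Phi x)))%:E).
  exact: measurable_int (psii n).
have pos n x : setT x -> (0 <= (dotp (psi n (Phi x)) (g (Phi x)))%:E)%E.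
  by move=> _; rewrite lee_fin psig mulr_ge0// powR_ge0.
have nd x : setT x -> nondecreasing_seq (fun n => (dotp (psi n (Phi x)) (g (Phi x)))%:E).
  move=> _ i j ij; rewrite lee_fin !psig ler_wpM2r ?powR_ge0// !indB.
  have : B i (Phi x) -> B j (Phi x) by move=> /le_trans; apply; rewrite ler_nat.
  by case: (B i _) => [->//|]; case: (B j _).
have := @cvg_monotone_convergence _ _ _ P setT measurableT _ mpsig pos nd.
rewrite (_ : (fun x => limn _) = (fun x => (enorm (g (Phi x)) `^ p)%:E)).
  by move=> cv; rewrite -(cvg_lim _ cv)//; apply: lime_le; [exact: cvgP cv|apply: nearW].
apply/funext => x; apply: lim_near_cst => //.
have [k xk] : exists k, B k (Phi x).
  exists (Num.truncn (enorm (g (Phi x)))).+1.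
  by rewrite /B ltW// truncnS_gt.
exists k => // n /= kn; rewrite psig indB.
by rewrite (_ : B n _) ?mul1r//; apply: le_trans xk _; rewrite ler_nat.
Qed.

End vector_conditional_expectation.

(** * From couplings to curves *)

Section measurable_near_minimiser.
Context {R : realType}.

Lemma powR_normr_continuous (p : R) : 0 < p -> continuous (fun a : R => `|a| `^ p).
Proof.
move=> p0 a; have [->|a0] := eqVneq a 0; last first.
  apply: (@continuous_comp _ _ _ (fun a : R => `|a|) (fun a : R => a `^ p)).
    exact: norm_continuous.
  apply: differentiable_continuous; apply/derivable1_diffP.
  by have [] := @is_derive1_powR _ p `|a|; rewrite ?normr_gt0.
rewrite /continuous_at normr0 powR0 ?gt_eqF//.
apply/cvgrPdist_lt => e e0; near=> b.
rewrite sub0r normrN ger0_norm ?powR_ge0//.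
have -> : e = (e `^ p^-1) `^ p by rewrite -powRrM mulVf ?gt_eqF// powRr1// ltW.
rewrite gt0_ltr_powR// ?nnegrE ?powR_ge0//; near: b.
apply/nbhs_ballP; exists (e `^ p^-1); first by rewrite /= powR_gt0.
by move=> b; rewrite /ball/= sub0r normrN.
Unshelve. all: by end_near. Qed.

Lemma measurable_mxD {dT : measure_display} (T : measurableType dT) m n (D : set T)
    (f g : T -> 'M[R]_(m, n)) : measurable D ->
  measurable_fun D f -> measurable_fun D g -> measurable_fun D (fun x => f x + g x).
Proof.
move=> mD mf mg; apply: measurable_fun_mx => // i j; under eq_fun do rewrite mxE.
by apply: measurable_funD; exact: measurable_coord.
Qed.

Lemma measurable_mxZ {dT : measure_display} (T : measurableType dT) m n (D : set T)
    (a : T -> R) (f : T -> 'M[R]_(m, n)) : measurable D ->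
  measurable_fun D a -> measurable_fun D f -> measurable_fun D (fun x => a x *: f x).
Proof.
move=> mD ma mf; apply: measurable_fun_mx => // i j; under eq_fun do rewrite mxE.
by apply: measurable_funM => //; exact: measurable_coord.
Qed.

Lemma measurable_mxB {dT : measure_display} (T : measurableType dT) m n (D : set T)
    (f g : T -> 'M[R]_(m, n)) : measurable D ->
  measurable_fun D f -> measurable_fun D g -> measurable_fun D (fun x => f x - g x).
Proof.
move=> mD mf mg; apply: measurable_fun_mx => // i j; under eq_fun do rewrite !mxE.
by apply: measurable_funB; exact: measurable_coord.
Qed.

Context {d N : nat}.
Variable p : R.
Hypothesis p_gt1 : 1 < p.

Let S (x : 'M[R]_(N, d)) z : R := \sum_(i < N) enorm (row i x - z) `^ p.

Lemma powR_enorm_sum_continuous (x : 'M[R]_(N, d)) : continuous (fun z : 'rV[R]_d => S x z).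
Proof.
apply: continuous_big => [|i _ z]; first exact: add_continuous.
under eq_fun do rewrite -[enorm _]ger0_norm ?enorm_ge0//.
apply: (@continuous_comp _ _ _ (fun z => enorm (row i x - z)) (fun a : R => `|a| `^ p)).
  exact: enorm_dist_continuous.
by apply: powR_normr_continuous; have p1 := p_gt1; lra.
Qed.

Let q (k : nat) : 'rV[R]_d := map_mx ratr (odflt (0 : 'M[rat]_(1, d)) (unpickle k)).

Let S_lt (x : 'M[R]_(N, d)) (z : 'rV[R]_d) (a : R) : S x z < a -> exists k, S x (q k) < a.
Proof.
move=> Sa; have cS := @powR_enorm_sum_continuous x z.
have : \forall z' \near z, S x z' < a by apply: (cS _ (lt_nbhsl Sa)).
move=> /nbhs_ballP[e /= e0 He].
have [r rz] := rat_mx_approx z e0.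
exists (pickle r); apply: He; rewrite /q pickleK/=; exact: ball_sym.
Qed.

Let mS z : measurable_fun setT (fun x => S x z).
Proof.
apply: measurable_sum => i; apply: measurable_powR_enorm.
by apply: measurable_mxB => //; exact: measurable_row.
Qed.

Let cost_lt (x : 'M[R]_(N, d)) (a : R) : infconv_cost p x < a -> exists k, S x (q k) < a.
Proof.
move=> /inf_lt[|_ [z _ <-]]; last exact: S_lt.
by exists (S x 0); exists 0.
Qed.

(** Continuity in [z] reduces the infimum to rational points, so a strict sublevel set is a
    countable union of measurable sets. *)
Lemma measurable_infconv_cost : measurable_fun setT (@infconv_cost R d N p).
Proof.
apply: (measurability _ (RGenInftyO.measurableE R)).
move=> _ [_ [a ->] <-]; rewrite setTI.
rewrite (_ : _ @^-1` _ = \bigcup_k ((fun x => S x (q k)) @^-1` `]-oo, a[)).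
  apply: bigcup_measurable => k _; rewrite -[X in measurable X]setTI; exact: mS.
apply/seteqP; split => x /=; rewrite in_itv/=.
  by move=> /cost_lt[k ka]; exists k => //=; rewrite in_itv.
by move=> [k _ /=]; rewrite in_itv/=; apply: le_lt_trans; exact: infconv_cost_le.
Qed.

(** The selection takes the first rational point, in a fixed enumeration, whose cost is below the
    infimum plus [e]; its level sets are differences of measurable sets. *)
Lemma measurable_near_minimiser (e : R) : 0 < e ->
  exists2 z : 'M[R]_(N, d) -> 'rV[R]_d, measurable_fun setT z &
    forall x, \sum_(i < N) enorm (row i x - z x) `^ p <= infconv_cost p x + e.
Proof.
move=> e0; pose good k x := S x (q k) < infconv_cost p x + e.
have ex x : exists k, good k x by apply: cost_lt; rewrite ltrDl.
pose k x := ex_minn (ex x).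
have mgood n : measurable [set x | good n x].
  rewrite (_ : [set x | _] = (fun x => S x (q n) - infconv_cost p x) @^-1` `]-oo, e[).
    rewrite -[X in measurable X]setTI; apply: measurable_funB => //.
    exact: measurable_infconv_cost.
  by apply/seteqP; split=> x /=; rewrite in_itv/= ltrBlDl.
have kE n : k @^-1` [set n] = [set x | good n x] `\` \bigcup_(m in `I_n) [set x | good m x].
  apply/seteqP; split => x /=; rewrite /k; case: ex_minnP => m gm mmin.
    move=> <-; split=> // -[l /= lm gl].
    by move: (mmin _ gl); rewrite leqNgt lm.
  move=> [gn ngn]; apply/eqP; rewrite eqn_leq mmin//= leqNgt; apply/negP => mn.
  by apply: ngn; exists m; [exact: mn|exact: gm].
exists (q \o k).
  move=> _ B mB; rewrite setTI.
  rewrite (_ : _ @^-1` B = \bigcup_(n in [set n | B (q n)]) (k @^-1` [set n])).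
    apply: bigcup_measurable => n _; rewrite kE; apply: measurableD => //.
    exact: bigcup_measurable.
  apply/seteqP; split=> x /=; first by move=> Bx; exists (k x).
  by move=> [n /= Bn kn]; rewrite kn.
move=> x /=; rewrite /k; case: ex_minnP => m /ltW gm _; exact: gm.
Qed.

End measurable_near_minimiser.

(** * Test functions on the strip and along straight paths *)

Section test_functions.
Context {R : realType} {d : nat}.
Implicit Types (psi phi : R * 'rV[R]_d -> R).

(** The support condition of [Cc1] concerns times in [0, 1], so derivatives are seen to vanish off
    [K] at interior times; continuity in time carries this to the end points. *)
Lemma strip_bounded psi (K : set 'rV[R]_d) : continuous psi -> compact K ->
  (forall t y, 0 < t < 1 -> ~ K y -> psi (t, y) = 0) ->
  exists M, forall t y, 0 <= t <= 1 -> `|psi (t, y)| <= M.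
Proof.
move=> cpsi cK psi0.
have [M [_ MB]] : bounded_set (psi @` (`[0, 1] `*` K)).
  apply: compact_bounded; apply: continuous_compact.
    by apply: continuous_subspaceT.
  apply: compact_setX => //; exact: segment_compact.
exists (`|M| + 1) => t y t01.
have [Ky|Ky] := pselect (K y).
  apply: (MB (`|M| + 1)); first by rewrite (le_lt_trans (ler_norm M))// ltrDl.
  by exists (t, y) => //; split => //=; rewrite in_itv.
rewrite (_ : psi _ = 0) ?normr0 ?addr_ge0//.
apply: contrapT => /eqP psi_neq0.
have c : continuous (fun s : R => psi (s, y)).
  move=> s; apply: (@continuous_comp _ _ _ (fun s : R => (s, y)) psi); last exact: cpsi.
  apply: differentiable_continuous; apply: differentiable_pair; first exact: ex_diff.
  exact: differentiable_cst.
have : \forall s \near t, psi (s, y) != 0 by exact: (cvgr_neq0 _ (c t) psi_neq0).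
move=> /nbhs_ballP[e /= e0 He].
(* Moving [t] by the fraction [k] towards [1 / 2] gives an interior time within [e] of [t], where
   [psi] should be both zero and nonzero. *)
pose k := Num.min (1 / 2) e.
have k0 : 0 < k by rewrite lt_min e0 andbT; lra.
have k1 : k <= 1 / 2 by rewrite ge_min lexx.
have ke : k <= e by rewrite ge_min lexx orbT.
have [t0 t1] := andP t01.
suff /He /= : ball t e (t + k * (1 / 2 - t)).
  rewrite psi0 ?eqxx//; apply/andP; split; nra.
rewrite /ball/= opprD addrA subrr sub0r normrN normrM (ger0_norm (ltW k0)).
rewrite (lt_le_trans _ ke)// gtr_pMr// ltr_norml; apply/andP; split; lra.
Qed.

Lemma Cc1_continuous phi : Cc1 phi -> continuous phi.
Proof. by case=> dphi _ _ z; exact: differentiable_continuous. Qed.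

Lemma Cc1_bounded phi : Cc1 phi ->
  exists M, forall t y, 0 <= t <= 1 -> `|phi (t, y)| <= M.
Proof.
move=> cphi; have cphi' := Cc1_continuous cphi; case: cphi => dphi Dphi [K cK phi0].
apply: (strip_bounded cphi' cK) => t y /andP[t0 t1]; apply: phi0; by rewrite !ltW.
Qed.

Lemma Cc1_derive_bounded phi w : Cc1 phi ->
  exists M, forall t y, 0 <= t <= 1 -> `|'D_w phi (t, y)| <= M.
Proof.
case=> dphi Dphi [K cK phi0]; apply: (strip_bounded (Dphi w) cK) => t y t01 Ky.
rewrite (@near_eq_derive _ _ _ phi (cst 0)) ?derive_cst//.
  exists ([set` `]0 : R, 1[], ~` K).
  split => /=; first by apply: near_in_itvoo; rewrite in_itv.
  apply: open_nbhs_nbhs; split => //; apply: closed_openC.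
  by apply: compact_closed => //; exact: norm_hausdorff.
by move=> [s x] [/=]; rewrite in_itv/= => /andP[s0 s1] Kx; rewrite /cst phi0 ?ltW.
Qed.

Lemma affine_path_ftc phi (x f : 'rV[R]_d) : Cc1 phi ->
  (\int[lebesgue_measure]_(t in `[0%R, 1%R])
     ((dt phi (t, x + t *: f) + dotp (gradx phi (t, x + t *: f)) f)%:E) =
   (phi (1, x + f))%:E - (phi (0, x))%:E)%E.
Proof.
case=> dphi Dphi _.
pose a (t : R) : R * 'rV[R]_d := (t, x + t *: f).
have da t : differentiable a t.
  apply: differentiable_pair; first exact: ex_diff.
  apply: differentiableD; first exact: differentiable_cst.
  exact: ex_diff.
have ca : continuous a by move=> t; exact: differentiable_continuous.
have aE (t h : R) : a (h *: (1 : R) + t) = h *: ((1, f) : R * 'rV[R]_d) + a t.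
  rewrite /a; congr (_, _) => /=.
  by rewrite addrCA; congr (_ + _); rewrite scalerDl [h *: 1]mulr1.
have dh (t : R) : is_derive t 1 (phi \o a) ('D_((1, f) : R * 'rV[R]_d) phi (a t)).
  apply: DeriveDef.
    by apply/derivable1_diffP; exact: differentiable_comp.
  have E : (fun h : R => h^-1 *: (((phi \o a) \o shift t) (h *: (1 : R)) - (phi \o a) t)) =
      (fun h : R => h^-1 *: ((phi \o shift (a t)) (h *: ((1, f) : R * 'rV[R]_d)) - phi (a t))).
    by apply/funext => h /=; rewrite aE.
  exact: (congr1 (fun F : R -> R => lim (F @ 0^')) E).
under eq_integral do rewrite -derive_dt_gradx//.
rewrite (@continuous_FTC2 _ (fun t => 'D_((1, f) : R * 'rV[R]_d) phi (a t)) (phi \o a))//=.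
- by rewrite /a scale1r scale0r addr0.
- apply: continuous_subspaceT => t; apply: (@continuous_comp _ _ _ a (fun z => 'D_((1, f) : R * 'rV[R]_d) phi z));
    [exact: ca|exact: Dphi].
- split.
  + by move=> t _; case: (dh t).
  + apply: cvg_at_right_filter; apply: (@continuous_comp _ _ _ a phi);
      [exact: ca|exact: differentiable_continuous].
  + apply: cvg_at_left_filter; apply: (@continuous_comp _ _ _ a phi);
      [exact: ca|exact: differentiable_continuous].
- by move=> t _; rewrite derive1E; case: (dh t).
Qed.

End test_functions.

(** * Displacement curves and their conditional velocities *)

Section displacement.
Context {R : realType} {d : nat} {dW : measure_display} {W : measurableType dW}.

Lemma integral_law {dT : measure_display} {T : measurableType dT} (P : probability W R)
    (f : W -> T) (mf : measurable_fun setT f) (g : T -> \bar R) :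
  measurable_fun setT g -> (\int[law P mf]_y g y = \int[P]_x g (f x))%E.
Proof.
move=> mg; rewrite integralE [RHS]integralE; congr (_ - _)%E.
- rewrite ge0_integral_law//; first by apply: eq_integral => x _; rewrite !funeposE.
  exact: measurable_funepos.
- rewrite ge0_integral_law//; first by apply: eq_integral => x _; rewrite !funenegE.
  exact: measurable_funeneg.
Qed.

(** Time becomes a random variable, so that time integrals and expectations combine in one
    probability space. *)
Lemma uniform01_exists : exists U : probability R R, forall g : R -> \bar R,
  measurable_fun setT g ->
  (\int[U]_t g t = \int[lebesgue_measure]_(t in `[0%R, 1%R]) g t)%E.
Proof.
have mid : measurable_fun setT (fun t : g_sigma_algebraType (R.-ocitv.-measurable) => t : R).
  exact: measurable_id.
pose U : probability R R := law (uniform_prob (@ltr01 R)) mid.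
have ge0 (h : R -> \bar R) : measurable_fun setT h -> (forall t, 0 <= h t)%E ->
    (\int[U]_t h t = \int[lebesgue_measure]_(t in `[0%R, 1%R]) h t)%E.
  by move=> mh h0; rewrite ge0_integral_law// integral_uniform// subr0 invr1 mul1e.
exists U => g mg; rewrite integralE [RHS]integralE.
by rewrite (ge0 _ (measurable_funepos mg))// (ge0 _ (measurable_funeneg mg)).
Qed.

Lemma measurable_dotp {dT : measure_display} {T : measurableType dT} (u v : T -> 'rV[R]_d) :
  measurable_fun setT u -> measurable_fun setT v -> measurable_fun setT (fun x => dotp (u x) (v x)).
Proof.
move=> mu mv; apply: measurable_sum => j; apply: measurable_funM; exact: measurable_coord.
Qed.

Variables (Q : probability W R) (p : R) (X0 X1 : W -> 'rV[R]_d).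
Hypotheses (p1 : 1 < p) (mX0 : measurable_fun setT X0) (mX1 : measurable_fun setT X1).
Hypotheses (X0p : (\int[Q]_w (enorm (X0 w) `^ p)%:E < +oo)%E)
  (X1p : (\int[Q]_w (enorm (X1 w) `^ p)%:E < +oo)%E).

Let p1' : 1 <= p. Proof. exact: ltW. Qed.

Lemma powR_enormD_lty (a b : W -> 'rV[R]_d) : measurable_fun setT a -> measurable_fun setT b ->
  (\int[Q]_w (enorm (a w) `^ p)%:E < +oo)%E -> (\int[Q]_w (enorm (b w) `^ p)%:E < +oo)%E ->
  (\int[Q]_w (enorm (a w + b w) `^ p)%:E < +oo)%E.
Proof.
move=> ma mb ap bp.
have ia := integrable_powR_enorm p1' ma ap.
have ib := integrable_powR_enorm p1' mb bp.
pose c : R := (1 / 2) `^ (1 - p).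
apply: (@le_lt_trans _ _ (\int[Q]_w (c%:E * (enorm (a w) `^ p)%:E + c%:E * (enorm (b w) `^ p)%:E))%E).
  apply: ge0_le_integralW => w _; first by rewrite lee_fin powR_ge0.
  rewrite -!EFinM -EFinD lee_fin.
  apply: (@le_trans _ _ ((enorm (a w) + enorm (b w)) `^ p)).
    apply: ge0_ler_powR; rewrite ?nnegrE ?addr_ge0 ?enorm_ge0 ?enorm_triangle//.
    by rewrite (le_trans _ p1').
  have := @powR_weighted_triangle _ p (1 / 2) (enorm (a w)) (enorm (b w)) p1.
  rewrite (_ : 1 - 1 / 2 = 1 / 2 :> R); last by field.
  by apply; rewrite ?enorm_ge0//; lra.
have i1 : Q.-integrable setT (fun w => c%:E * (enorm (a w) `^ p)%:E + c%:E * (enorm (b w) `^ p)%:E)%E.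
  by apply: integrableD => //; exact: integrableZl.
have := integrable_fin_num measurableT i1.
by rewrite fin_numElt => /andP[].
Qed.

Lemma powR_enormZ_lty (t : R) (a : W -> 'rV[R]_d) : measurable_fun setT a ->
  (\int[Q]_w (enorm (a w) `^ p)%:E < +oo)%E -> (\int[Q]_w (enorm (t *: a w) `^ p)%:E < +oo)%E.
Proof.
move=> ma ap; have ia := integrable_powR_enorm p1' ma ap.
under eq_integral do rewrite enormZ powRM ?normr_ge0 ?enorm_ge0// EFinM.
rewrite integralZl//.
have /fineK <- := integrable_fin_num measurableT ia.
by rewrite -EFinM ltry.
Qed.

Let f w := X1 w - X0 w.
Let mf : measurable_fun setT f. Proof. exact: measurable_mxB. Qed.
Let fp : (\int[Q]_w (enorm (f w) `^ p)%:E < +oo)%E.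
Proof.
have mN : measurable_fun setT (fun w => - X0 w).
  by under eq_fun do rewrite -scaleN1r; exact: measurable_mxZ.
have Np : (\int[Q]_w (enorm (- X0 w) `^ p)%:E < +oo)%E.
  rewrite (_ : (fun w => _) = (fun w => (enorm (X0 w) `^ p)%:E)); first exact: X0p.
  by apply/funext => w; rewrite enormN.
exact: (powR_enormD_lty mX1 mN X1p Np).
Qed.

Let X (t : R) w := X0 w + t *: f w.
Let mX t : measurable_fun setT (X t).
Proof. by apply: measurable_mxD => //; exact: measurable_mxZ. Qed.
Let rho t : probability 'rV[R]_d R := law Q (mX t).

Lemma Pp_law (h : W -> 'rV[R]_d) (mh : measurable_fun setT h) :
  (\int[Q]_w (enorm (h w) `^ p)%:E < +oo)%E -> Pp p (law Q mh).
Proof.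
rewrite -(ge0_integral_law Q mh (g := fun y => (enorm y `^ p)%:E)) //.
  by apply/measurable_EFinP; apply: measurable_powR_enorm; exact: measurable_id.
by move=> y; rewrite lee_fin powR_ge0.
Qed.

(** The variable conditioned upon; keeping time in it makes the velocity a function of time and
    position. *)
Let Phi (z : R * W) : R * 'rV[R]_d := (z.1, X z.1 z.2).
Let mXpair : measurable_fun setT (fun z : R * W => X z.1 z.2).
Proof.
apply: measurable_mxD => //; first exact: measurableT_comp.
apply: measurable_mxZ => //; exact: measurableT_comp.
Qed.
Let mPhi : measurable_fun setT Phi.
Proof. exact: measurable_fun_pair. Qed.

Variable U : probability R R.
Hypothesis UE : forall g : R -> \bar R, measurable_fun setT g ->
  (\int[U]_t g t = \int[lebesgue_measure]_(t in `[0%R, 1%R]) g t)%E.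

Let P : probability (R * W)%type R := (U \x Q)%E.

(** Measurability in time is recorded as well: adding up the [N] time integrals in the action uses
    it. *)
Let tonelli (G : R * 'rV[R]_d -> R) : measurable_fun setT G -> (forall z, 0 <= G z) ->
  measurable_fun setT (fun t => \int[rho t]_y (G (t, y))%:E)%E /\
  (\int[lebesgue_measure]_(t in `[0%R, 1%R]) \int[rho t]_y (G (t, y))%:E = \int[P]_z (G (Phi z))%:E)%E.
Proof.
move=> mG G0; pose K (z : R * W) := (G (Phi z))%:E.
have mK : measurable_fun setT K by apply/measurable_EFinP; exact: measurableT_comp.
have K0 z : (0 <= K z)%E by rewrite lee_fin.
have mF := @measurable_fun_fubini_tonelli_F _ _ _ _ _ Q K mK K0.
have -> : (fun t => \int[rho t]_y (G (t, y))%:E)%E = fubini_F Q K.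
  apply/funext => t; rewrite (ge0_integral_law Q (mX t) (g := fun y => (G (t, y))%:E))//.
    by apply/measurable_EFinP; apply: (measurableT_comp mG); exact: pair1_measurable.
  by move=> y; rewrite lee_fin.
by split=> //; rewrite [RHS](@fubini_tonelli1 _ _ _ _ _ U Q K mK K0) UE.
Qed.

Let displacement_weak (g : R * 'rV[R]_d -> 'rV[R]_d) : measurable_fun setT g ->
  (\int[P]_z (enorm (g (Phi z)) `^ p)%:E < +oo)%E ->
  (\int[P]_z (enorm (f z.2) `^ p)%:E < +oo)%E ->
  (forall (u : R * 'rV[R]_d -> 'rV[R]_d) (M : R), measurable_fun setT u ->
      (forall y j, `|u y ord0 j| <= M) ->
      (\int[P]_x (dotp (u (Phi x)) (g (Phi x)))%:E = \int[P]_x (dotp (u (Phi x)) (f x.2))%:E)%E) ->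
  weak_continuity_eq rho (fun t y => g (t, y)) (law Q mX0) (law Q mX1).
Proof.
move=> mg gp fp2 swap phi cphi.
have mgP : measurable_fun setT (fun z => g (Phi z)) by exact: (measurableT_comp mg mPhi).
have mf2 : measurable_fun setT (fun z : R * W => f z.2) by exact: measurableT_comp.
have ig j := integrable_coord j mgP (integrable_enorm p1' mgP gp).
have jf j := integrable_coord j mf2 (integrable_enorm p1' mf2 fp2).
have [dphi Dphi _] := cphi.
have cphi' := Cc1_continuous cphi.
have mphi := continuous_measurable_prod cphi'.
have [M0 M0P] := Cc1_bounded cphi.
have [M1 M1P] := Cc1_derive_bounded ((1, 0) : R * 'rV[R]_d) cphi.
have /choice[M2 M2P] j := Cc1_derive_bounded ((0, delta_mx ord0 j) : R * 'rV[R]_d) cphi.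
have M1_ge0 : 0 <= M1 by apply: le_trans (M1P 0 0 _); rewrite ?lexx ?ler01.
have M2_ge0 j : 0 <= M2 j by apply: le_trans (M2P j 0 0 _); rewrite ?lexx ?ler01.
(* Derivatives of [phi] are bounded only for times in [0, 1]; cutting off with [I] gives globally
   bounded test fields for [swap] and leaves the time integral unchanged. *)
pose I (t : R) : R := \1_`[0, 1] t.
have I1 t : t \in `[0, 1] -> I t = 1.
  by move=> t01; rewrite /I indicE mem_set.
have I0 t : ~~ (0 <= t <= 1) -> I t = 0.
  by move=> t01; rewrite /I indicE memNset//= in_itv; exact/negP.
have mI : measurable_fun setT (fun z : R * 'rV[R]_d => I z.1).
  by apply: (measurableT_comp (f := I)) => //; exact: measurable_indic.
pose s (z : R * 'rV[R]_d) := I z.1 * dt phi z.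
pose u (z : R * 'rV[R]_d) : 'rV[R]_d := I z.1 *: gradx phi z.
have ms : measurable_fun setT s.
  by apply: measurable_funM => //; apply: continuous_measurable_prod; exact: Dphi.
have mu : measurable_fun setT u.
  apply: measurable_mxZ => //; apply: measurable_fun_mx => // i j.
  under eq_fun do rewrite mxE; apply: continuous_measurable_prod; exact: Dphi.
have sM z : `|s z| <= M1.
  case: z => t y; rewrite /s; case: (boolP (0 <= t <= 1)) => t01.
    by rewrite I1 ?in_itv// mul1r M1P.
  by rewrite I0// mul0r normr0.
have uM z j : `|u z ord0 j| <= \sum_k M2 k.
  rewrite (bigD1 j)//= (le_trans (y := M2 j))//; last by rewrite lerDl sumr_ge0.
  case: z => t y; rewrite /u !mxE; case: (boolP (0 <= t <= 1)) => t01.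
    by rewrite I1 ?in_itv// mul1r M2P.
  by rewrite I0// mul0r normr0.
pose H z := s z + dotp (u z) (g z).
have mH : measurable_fun setT H by apply: measurable_funD => //; exact: measurable_dotp.
have msP : measurable_fun setT (s \o Phi) by exact: measurableT_comp.
have muP : measurable_fun setT (u \o Phi) by exact: measurableT_comp.
have is_ : P.-integrable setT (fun z => (s (Phi z))%:E).
  by apply: (bounded_integrable _ msP (M := M1)) => z; exact: sM.
have iug : P.-integrable setT (fun z => (dotp (u (Phi z)) (g (Phi z)))%:E).
  by apply: (@integrable_dotp _ _ _ _ P (u \o Phi) (fun z => g (Phi z)) (\sum_k M2 k) muP) => // z j; exact: uM.
have iuf : P.-integrable setT (fun z => (dotp (u (Phi z)) (f z.2))%:E).
  by apply: (@integrable_dotp _ _ _ _ P (u \o Phi) (fun z => f z.2) (\sum_k M2 k) muP) => // z j; exact: uM.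
pose K (z : R * W) : \bar R := (H (Phi z))%:E.
pose K' (z : R * W) : \bar R := (s (Phi z) + dotp (u (Phi z)) (f z.2))%:E.
have iK : P.-integrable setT K.
  rewrite (_ : K = (fun z => (s (Phi z))%:E + (dotp (u (Phi z)) (g (Phi z)))%:E)%E).
    exact: integrableD.
  by apply/funext => z; rewrite -EFinD.
have iK' : P.-integrable setT K'.
  rewrite (_ : K' = (fun z => (s (Phi z))%:E + (dotp (u (Phi z)) (f z.2))%:E)%E).
    exact: integrableD.
  by apply/funext => z; rewrite -EFinD.
have KK' : (\int[P]_z K z = \int[P]_z K' z)%E.
  rewrite /K /K' /H; under eq_integral do rewrite EFinD.
  under [RHS]eq_integral do rewrite EFinD.
  by rewrite !integralD// (swap u _ mu uM).
(* Fubini in one order, the exchange of [g] for the true velocity [f], then Fubini in the other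
   order, so that the time integral runs along single paths. *)
transitivity (\int[lebesgue_measure]_(t in `[0%R, 1%R]) fubini_F Q K t)%E.
  apply: eq_integral => t t01; rewrite /fubini_F -(@integral_law _ _ Q _ (mX t) (fun y => (H (t, y))%:E)).
    apply: eq_integral => y _; congr (_%:E).
    have tI : I t = 1 by apply: I1; move: t01; rewrite inE.
    by rewrite /H /s /u/= tI mul1r scale1r.
  by apply/measurable_EFinP; apply: (measurableT_comp mH); exact: pair1_measurable.
rewrite -UE; last exact: (measurable_fubini_F iK).
rewrite (integral12_prod_meas1 iK) KK' -(integral21_prod_meas1 iK').
transitivity (\int[Q]_w ((phi (1, X1 w))%:E - (phi (0, X0 w))%:E))%E.
  apply: eq_integral => w _; rewrite /fubini_G UE; last first.
    exact: (measurableT_comp (measurable_int _ iK') (pair2_measurable w)).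
  rewrite -[X1 w](subrK (X0 w)) [_ - _ + _]addrC -affine_path_ftc//.
  apply: eq_integral => t t01; congr (_%:E).
  have tI : I t = 1 by apply: I1; move: t01; rewrite inE.
  by rewrite /s /u/= tI mul1r scale1r.
have mend (t : R) (Y : W -> 'rV[R]_d) : measurable_fun setT Y -> measurable_fun setT (fun w => phi (t, Y w)).
  by move=> mY; apply: (measurableT_comp mphi); exact: measurable_fun_pair.
rewrite integralB//; first last.
- apply: (bounded_integrable Q (mend 0 X0 mX0) (M := M0)) => w; apply: M0P; rewrite ?lexx ?ler01//.
- apply: (bounded_integrable Q (mend 1 X1 mX1) (M := M0)) => w; apply: M0P; rewrite ?lexx ?ler01//.
congr (_ - _)%E.
- rewrite (@integral_law _ _ Q _ mX1 (fun y => (phi (1, y))%:E))//.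
  by apply/measurable_EFinP; apply: (measurableT_comp mphi); exact: pair1_measurable.
- rewrite (@integral_law _ _ Q _ mX0 (fun y => (phi (0, y))%:E))//.
  by apply/measurable_EFinP; apply: (measurableT_comp mphi); exact: pair1_measurable.
Qed.

Lemma displacement_exists :
  exists (rho : R -> probability 'rV[R]_d R) (v : R -> 'rV[R]_d -> 'rV[R]_d),
  [/\ [/\ measurable_curve p rho, borel_field v &
    (\int[lebesgue_measure]_(t in `[0%R, 1%R]) \int[rho t]_x (enorm (v t x))%:E < +oo)%E],
    measurable_fun setT (fun t => \int[rho t]_x (enorm (v t x) `^ p)%:E)%E,
    (\int[lebesgue_measure]_(t in `[0%R, 1%R]) \int[rho t]_x (enorm (v t x) `^ p)%:E <=
     \int[Q]_w (enorm (X1 w - X0 w) `^ p)%:E)%E &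
    weak_continuity_eq rho v (law Q mX0) (law Q mX1)].
Proof.
have mf2 : measurable_fun setT (fun z : R * W => f z.2) by exact: measurableT_comp.
have fQP : (\int[P]_z (enorm (f z.2) `^ p)%:E = \int[Q]_w (enorm (f w) `^ p)%:E)%E.
  rewrite (@fubini_tonelli2 _ _ _ _ _ U Q (fun z => (enorm (f z.2) `^ p)%:E))//; last 2 first.
  - by apply/measurable_EFinP; exact: measurable_powR_enorm.
  - by move=> z; rewrite lee_fin powR_ge0.
  apply: eq_integral => w _; rewrite /fubini_G/= integral_cst//.
  by rewrite [X in (_ * X)%E](probability_setT U) mule1.
have fpP : (\int[P]_z (enorm (f z.2) `^ p)%:E < +oo)%E by rewrite fQP.
have [g [mg gp swap]] := conditional_field_exists mPhi p1 mf2 fpP.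
have [_ gE] := tonelli (measurable_enorm mg) (fun z => enorm_ge0 (g z)).
have [mgp gpE] := tonelli (measurable_powR_enorm p mg) (fun z => powR_ge0 (enorm (g z)) p).
exists rho, (fun t y => g (t, y)); split; [split| | |].
- split=> [t _|A mA].
    apply: Pp_law; apply: (powR_enormD_lty mX0 _ X0p); first exact: measurable_mxZ.
    exact: powR_enormZ_lty mf fp.
  apply: measurable_funTS.
  have mA' : measurable ((fun z : R * W => X z.1 z.2) @^-1` A).
    by rewrite -[X in measurable X]setTI; exact: mXpair.
  have E t : xsection ((fun z : R * W => X z.1 z.2) @^-1` A) t = X t @^-1` A.
    by apply/seteqP; split=> w /=; rewrite /xsection/= inE.
  have -> : (fun t => rho t A) = Q \o xsection ((fun z : R * W => X z.1 z.2) @^-1` A).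
    by apply/funext => t; rewrite /= E.
  exact: measurable_fun_xsection.
- rewrite /borel_field; apply: measurable_funTS.
  by rewrite (_ : (fun z => _) = g)//; apply/funext => -[].
- rewrite [ltLHS]gE.
  have ig : P.-integrable setT (fun z => (enorm (g (Phi z)))%:E).
    apply: (integrable_enorm p1'); first exact: measurableT_comp.
    exact: le_lt_trans gp fpP.
  by have := integrable_fin_num measurableT ig; rewrite fin_numElt => /andP[].
- exact: mgp.
- by rewrite [leLHS]gpE -fQP.
exact: displacement_weak mg (le_lt_trans gp fpP) fpP swap.
Qed.

End displacement.

Lemma dynamic_value_le_cost (R : realType) (d N : nat) (p : R)
    (mu : 'I_N -> probability 'rV[R]_d R) gamma (e : R) : (0 < N)%N -> 1 < p ->
  (forall i, Pp p (mu i)) -> couplings mu gamma -> 0 < e ->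
  (dynamic_value p mu <= \int[gamma]_x (infconv_cost p x)%:E + e%:E)%E.
Proof.
move=> N0 p1 mup cg e0; have p1' : 1 <= p by lra.
have [z mz zP] := @measurable_near_minimiser R d N p p1 e e0.
have mrow i := @measurable_row R N d i.
have rowp i : (\int[gamma]_x (enorm (row i x) `^ p)%:E < +oo)%E.
  rewrite (coupling_ge0_integral i (g := fun y => (enorm y `^ p)%:E) cg); [exact: mup| |].
  - by apply/measurable_EFinP; apply: measurable_powR_enorm; exact: measurable_id.
  - by move=> y; rewrite lee_fin powR_ge0.
have irow i := integrable_powR_enorm p1' (mrow i) (rowp i).
have mdiff i : measurable_fun setT (fun x : 'M[R]_(N, d) => row i x - z x).
  exact: measurable_mxB.
(* Comparing the near-minimiser with the choice [z = 0] gives a bound by moments of the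
   marginals. *)
have diff_le i x : enorm (row i x - z x) `^ p <= \sum_j enorm (row j x) `^ p + e.
  apply: (@le_trans _ _ (infconv_cost p x + e)).
    apply: le_trans (zP x); rewrite (bigD1 i)//= lerDl; apply: sumr_ge0 => j _; exact: powR_ge0.
  rewrite lerD2r (le_trans (@infconv_cost_le R d N p x 0))//; apply: ler_sum => j _.
  by rewrite subr0.
have diffp i : (\int[gamma]_x (enorm (row i x - z x) `^ p)%:E < +oo)%E.
  have ib : gamma.-integrable setT (fun x => (\sum_j enorm (row j x) `^ p + e)%:E).
    rewrite (_ : (fun _ => _) = (fun x => (\sum_(j < N) (enorm (row j x) `^ p)%:E) + e%:E)%E).
      apply: integrableD => //; first by apply: integrable_sum => // j _; exact: irow.
      exact: finite_measure_integrable_cst.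
    by apply/funext => x; rewrite sumEFin -EFinD.
  apply: (@le_lt_trans _ _ (\int[gamma]_x (\sum_j enorm (row j x) `^ p + e)%:E)%E).
    by apply: ge0_le_integralW => x _; rewrite lee_fin ?powR_ge0 ?diff_le.
  by have := integrable_fin_num measurableT ib; rewrite fin_numElt => /andP[].
(* [z] is a row minus its displacement, both with finite p-th moment; [N > 0] provides the row. *)
have zp : (\int[gamma]_x (enorm (z x) `^ p)%:E < +oo)%E.
  pose i0 := Ordinal N0.
  have mN : measurable_fun setT (fun x : 'M[R]_(N, d) => -1 *: (row i0 x - z x)).
    by apply: measurable_mxZ.
  have E : (fun x => (enorm (z x) `^ p)%:E) =
      (fun x => (enorm (row i0 x + -1 *: (row i0 x - z x)) `^ p)%:E).
    by apply/funext => x; congr ((enorm _ `^ _)%:E); rewrite scaleN1r opprB addrC subrK.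
  rewrite E.
  have Np := powR_enormZ_lty p1 (-1) (mdiff i0) (diffp i0).
  have F := powR_enormD_lty p1 (mrow i0) mN (rowp i0) Np.
  exact: F.
have [U UE] := uniform01_exists (R := R).
have /choice[rv rvP] (i : 'I_N) : exists rv : (R -> probability 'rV[R]_d R) * (R -> 'rV[R]_d -> 'rV[R]_d),
  [/\ [/\ measurable_curve p rv.1, borel_field rv.2 &
    (\int[lebesgue_measure]_(t in `[0%R, 1%R]) \int[rv.1 t]_x (enorm (rv.2 t x))%:E < +oo)%E],
    measurable_fun setT (fun t => \int[rv.1 t]_x (enorm (rv.2 t x) `^ p)%:E)%E,
    (\int[lebesgue_measure]_(t in `[0%R, 1%R]) \int[rv.1 t]_x (enorm (rv.2 t x) `^ p)%:E <=
     \int[gamma]_w (enorm (row i w - z w) `^ p)%:E)%E &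
    weak_continuity_eq rv.1 rv.2 (law gamma mz) (law gamma (mrow i))].
  have [rho [v rvP]] := displacement_exists p1 mz (mrow i) zp (rowp i) UE.
  by exists (rho, v).
have adm : admissible p mu (fun i => (rv i).1, fun i => (rv i).2).
  split; first by move=> i; case: (rvP i).
  exists (law gamma mz); first exact: Pp_law.
  move=> i phi cphi; case: (rvP i) => _ _ _ /(_ phi cphi) /= ->.
  by congr (_ - _)%E; apply: eq_measure_integral => A mA _; exact: (cg i A mA).
apply: (@le_trans _ _ (action p (fun i => (rv i).1) (fun i => (rv i).2))).
  by apply: ereal_inf_lbound; exists (fun i => (rv i).1, fun i => (rv i).2).
(* Here the sum must leave the integral with equality, hence the appeal to measurability in time. *)
rewrite /action ge0_integral_sum//; first last.
- by move=> i t _; apply: integral_ge0 => x _; rewrite lee_fin powR_ge0.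
- by move=> i; apply: measurable_funTS; case: (rvP i).
apply: (@le_trans _ _ (\sum_(i < N) \int[gamma]_w (enorm (row i w - z w) `^ p)%:E)%E).
  by apply: lee_sum => i _; case: (rvP i).
rewrite -ge0_integral_sum//; first last.
- by move=> i x _; rewrite lee_fin powR_ge0.
- by move=> i; apply/measurable_EFinP; exact: measurable_powR_enorm.
apply: (@le_trans _ _ (\int[gamma]_x ((infconv_cost p x)%:E + e%:E))%E).
  apply: ge0_le_integralW => x _; rewrite sumEFin ?lee_fin; last exact: zP.
  by apply: sumr_ge0 => i _; exact: powR_ge0.
rewrite ge0_integralD//; first last.
- by move=> x _; rewrite lee_fin ltW.
- by apply/measurable_EFinP; exact: measurable_infconv_cost.
- by move=> x _; rewrite lee_fin infconv_cost_ge0.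
by rewrite integral_cst// [X in (_ + _ * X)%E](probability_setT gamma) mule1.
Qed.

Theorem theorem2p1 (R : realType) (d N : nat) (p : R)
    (mu : 'I_N -> probability 'rV[R]_d R)
    (d_gt0 : (0 < d)%N) (N_gt0 : (0 < N)%N) (p_gt1 : 1 < p)
    (mu_ac : forall i, Pp_ac p (mu i)) :
  mmot_value (infconv_cost p) mu = dynamic_value p mu.
Proof.
have mup i : Pp p (mu i) by case: (mu_ac i).
apply/eqP; rewrite eq_le; apply/andP; split.
  by apply: le_ereal_inf_tmp => _ [rv adm <-]; exact: mmot_value_le_action.
apply: le_ereal_inf_tmp => _ [gamma cg <-].
by apply/lee_addgt0Pr => e e0; exact: dynamic_value_le_cost.
Qed.
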